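(* Let $n\ge 3$ and $2\le k<n$ be integers, and let $\gamma$ be a real number with $$0<\gamma<\min\Big\{\frac{2k}{n},\ 1+\frac{2k-n}{2k^2+n}\Big\}.$$ Then there exists a constant $\eta_*=\eta_*(n,k,\gamma)>0$ such that for every $\lambda\in\Gamma_k$ with $a:=\lambda_1>\lambda_2\ge\cdots\ge\lambda_n$ satisfying $$0<\frac{F}{a^k}\le \eta_*,\qquad F=\sigma_k(\lambda),$$ one has $$\mathcal Q_\gamma(\lambda;\xi)\ge 0\qquad\text{for all }\xi\in\mathbb R^n.$$
   Context: For $\lambda\in\mathbb R^n$, $\sigma_j(\lambda)$ is the $j$-th elementary symmetric polynomial, with $\sigma_0=1$. $\sigma_j(\lambda|i)$ (resp. $\sigma_j(\lambda|ij)$) is the value obtained by setting $\lambda_i=0$ (resp. $\lambda_i=\lambda_j=0$). The Gårding cone is $\Gamma_k=\{\lambda\in\mathbb R^n:\sigma_j(\lambda)>0,\ 1\le j\le k\}$. Put $F=\sigma_k(\lambda)$, $F^{ii}=\sigma_{k-1}(\lambda|i)$, $F^{ii,jj}=\sigma_{k-2}(\lambda|ij)$ for $i\ne j$ and $F^{ii,ii}=0$. For $a=\lambda_1>\lambda_2\ge\cdots\ge\lambda_n$ and $\xi\in\mathbb R^n$, $$\mathcal Q_\gamma(\lambda;\xi)=\frac{2}{aF}\Big(\sum_{i=1}^nF^{ii}\xi_i\Big)^2-\gamma\frac{F^{11}}{a^2}\xi_1^2-\frac1a\sum_{i,j=1}^nF^{ii,jj}\xi_i\xi_j+\frac2a\sum_{p=2}^n\frac{F^{pp}}{a-\lambda_p}\xi_p^2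 .$$ *)

(* Defs.v *)
From HB Require Import structures.
From mathcomp Require Import all_boot all_order all_algebra.
From mathcomp Require Import reals.
From mathcomp Require mpoly.

Set Implicit Arguments.
Unset Strict Implicit.
Unset Printing Implicit Defensive.

Import Order.TTheory GRing.Theory Num.Theory.

Local Open Scope ring_scope.

Section Defs.
Variables (R : realType) (n : nat).
Implicit Types (l xi : 'rV[R]_n) (i j : 'I_n) (k : nat).

Definition sigma k l : R := mpoly.meval (fun i => l 0 i) (mpoly.mesym n R k).

Lemma sigmaE k l :
  sigma k l = \sum_(A : {set 'I_n} | #|A| == k) \prod_(i in A) l 0 i.
Proof.
pose v i := l 0 i.
rewrite /sigma /mpoly.mesym (big_morph _ (mpoly.mevalD v) (mpoly.meval0 v)).
apply: eq_bigr => A _; rewrite (big_morph _ (mpoly.mevalM v) (mpoly.meval1 v)).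
by apply: eq_bigr => i _; rewrite mpoly.mevalXU.
Qed.

Definition zero_at i l : 'rV[R]_n := \row_j (if j == i then 0 else l 0 j).

(* sigma_k(l|i) and sigma_k(l|ij) *)
Definition sigma1 k l i : R := sigma k (zero_at i l).
Definition sigma2 k l i j : R := sigma k (zero_at j (zero_at i l)).

Definition Garding k l : Prop :=
  forall j : nat, (1 <= j <= k)%N -> 0 < sigma j l.

(* F^{ii} and F^{ii,jj} for F = sigma_k; meant for k >= 2, where the natural
   number subtractions k.-1 and k.-2 are not truncated. *)
Definition dF k l i : R := sigma1 k.-1 l i.
Definition ddF k l i j : R := if i == j then 0 else sigma2 k.-2 l i j.

(* In this and the next definition i1 stands for the index written 1 in the
   usual numbering from 1 to n; it is the element of 'I_n of value 0, see
   first_ord below. *)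
Definition Qform (i1 : 'I_n) k (gamma : R) l xi : R :=
  let a := l 0 i1 in
  let F := sigma k l in
  2 / (a * F) * (\sum_i dF k l i * xi 0 i) ^+ 2
  - gamma * (dF k l i1 / a ^+ 2) * xi 0 i1 ^+ 2
  - a^-1 * (\sum_i \sum_j ddF k l i j * xi 0 i * xi 0 j)
  + 2 / a * (\sum_(p | p != i1) dF k l p / (a - l 0 p) * xi 0 p ^+ 2).

(* l_1 > l_2 >= ... >= l_n, for i1 the first index *)
Definition simple_top_sorted (i1 : 'I_n) l : Prop :=
  (forall p : 'I_n, p != i1 -> l 0 p < l 0 i1) /\
  (forall p q : 'I_n, p != i1 -> (p <= q)%N -> l 0 q <= l 0 p).

End Defs.

Definition first_ord n (hn : (3 <= n)%N) : 'I_n := Ordinal (ltnW (ltnW hn)).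

(* Main.v *)
Require Import Defs.
From HB Require Import structures.
From mathcomp Require Import all_boot all_order all_algebra.
From mathcomp Require Import reals.
From mathcomp Require Import ring lra.

(** Divide by [a], so that [lambda_1 = 1], and let [x] be the other [n - 1]
entries; they are all smaller than 1 and lie in the cone Gamma_{k-1}.  Put
[s = sigma_{k-1}(x)], [q = sigma_k(x) / s] and [h = 1 + q], so that
[F = s h].  For [xi = (xi_1, u)] write [q'] and [q''] for the first two
derivatives of [q] at [x] in the direction [u], and [z] for the logarithmic
derivative of [s].  Since sigma_{k-1}^{1/(k-1)} is concave, completing squares
([normalized_form_ge0]) bounds the form divided by [s] from below by
[(c / h) (xi_1 + q')^2 - gamma xi_1^2 + P].  Here [1 / c] exceeds
[k / (k + 1)] by as little as desired, and
[P = delta h z^2 + 2 sum_p (F^{pp} / s) u_p^2 / (1 - x_p) - q''] is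
[reduced_form], with [delta > 0] what the choice of [c] leaves over.  Hence it
suffices to find [U] with [q'^2 <= U P] and [h / c + U <= 1 / gamma].

The main tool is [quot_concave], a quantitative form of the concavity of the
quotient [q] of consecutive elementary symmetric polynomials: for every
positive [w],
[2 q'^2 <= (q(x + w) - q(x)) (2 sum_p q_p u_p^2 / w_p - q'')],
where the [q_p] are the partial derivatives.
By the Marcus-Lopes identity, [k q(x)] is the sum over [p] of the parallel
sums [x_p g_p / (x_p + g_p)], where [g_p] is the quotient of order [k - 1]
without the variable [p].  Inequalities of the above shape survive parallel
sums ([jet_bound_parallel]) and sums ([jet_bound_sum]), and for a single
variable there is equality, so induction on [k] applies.

Three choices of [U] then cover all small values of [F].
- If [h] is small, [w = 1 - x] moves [x] to the vector of ones, where
  [q = (n - k) / k].  This gives [U = (n / k - h) / 2], and the condition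
  becomes [gamma < 2 k / n].
- Otherwise [s = F / h] is small, and Maclaurin's inequality makes
  [sigma_{k-2}(x) / s] huge.  Then all [g_p] are small by Newton's
  inequalities, and if moreover [q] is not much below 0, a small constant [w]
  is allowed; the resulting [U] is small ([reduced_form_bound_shift]).
- If [s] is small and [q] stays away from 0 and from -1, the form of
  [quot_concave] for [w = 1 - x] is tested against the vector [x - x^2]
  by the Cauchy-Schwarz inequality.  Up to the derivative of
  [sigma_{k+1} / sigma_{k-1}], which is negligible here by Newton's
  inequalities, this yields [U] close to [(1 / k - q) / 2]
  ([reduced_form_bound_degenerate]).
In the last two cases the condition [h / c + U <= 1 / gamma] follows from the
second upper bound on [gamma], which reads
[k / (k + 1) + n / (2 k (k + 1)) < 1 / gamma]. *)

Set Implicit Arguments.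
Unset Strict Implicit.
Unset Printing Implicit Defensive.

Import Order.TTheory GRing.Theory Num.Theory.

Local Open Scope ring_scope.

(** * Elementary symmetric polynomials and their derivatives *)

Section ElementarySymmetric.
Variables (R : comNzRingType) (T : finType).
Implicit Types (x y z : T -> R) (A B : {set T}) (j : nat).

(** The elementary symmetric polynomial of degree [j] in the variables indexed by
[A].  Deleting variables amounts to shrinking [A], and the generating polynomial
makes the recursion [elsym_rem] immediate.  The ring is arbitrary because the
variables will also be polynomials in a time parameter. *)
Definition elsym x A j : R := (\prod_(i in A) (1 + x i *: 'X))`_j.

(** Degree [j - 1], with value 0 at [j = 0]: the coefficient of the removed
variable in [elsym_rem], hence also the partial derivative. *)
Definition pelsym x A j : R := if j is i.+1 then elsym x A i else 0.

Lemma elsym_rem x A p j : p \in A ->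
  elsym x A j = elsym x (A :\ p) j + x p * pelsym x (A :\ p) j.
Proof.
move=> pA; rewrite /elsym (big_setD1 p pA) /= mulrDl mul1r coefD -scalerAl coefZ.
by rewrite coefXM; case: j => [|j].
Qed.

Lemma elsym_zero x A : elsym x A 0 = 1.
Proof.
rewrite /elsym; elim/big_rec: _ => [|i p _ IH]; first by rewrite coef1.
by rewrite mulrDl mul1r coefD -scalerAl coefZ coefXM mulr0 addr0.
Qed.

Lemma elsym_set0 x j : elsym x set0 j.+1 = 0.
Proof. by rewrite /elsym big_set0 coef1. Qed.

Lemma eq_elsym x y A j : {in A, x =1 y} -> elsym x A j = elsym y A j.
Proof.
by move=> E; rewrite /elsym; congr (polyseq _)`_j; apply: eq_bigr => i /E->.
Qed.

Lemma setD1C A p q : A :\ p :\ q = A :\ q :\ p.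
Proof. by rewrite !setDDl setUC. Qed.

Lemma setD1_in A p q : p \in A -> q \in A :\ p -> p \in A :\ q.
Proof. by move=> pA; rewrite !inE eq_sym => /andP[-> _]; rewrite pA. Qed.

(** Each monomial of degree [j + 1] is counted once for each of its variables. *)
Lemma elsym_sum x A j :
  \sum_(p in A) x p * elsym x (A :\ p) j = j.+1%:R * elsym x A j.+1.
Proof.
have [n] := ubnP #|A|; elim: n A j => // n IH A j.
rewrite ltnS => An; have [->|[q qA]] := set_0Vmem A.
  by rewrite big_set0 elsym_set0 mulr0.
have Aq : (#|A :\ q| < n)%N by rewrite (cardsD1 q A) qA in An.
rewrite (big_setD1 q qA) /=.
have E p : p \in A :\ q -> x p * elsym x (A :\ p) j =
  x p * elsym x (A :\ q :\ p) j + x q * (x p * pelsym x (A :\ q :\ p) j).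
  by move=> pA; rewrite (elsym_rem _ _ (setD1_in qA pA)) setD1C mulrDr (mulrCA (x p)).
rewrite (eq_bigr _ E) big_split /= IH // (elsym_rem x j.+1 qA) mulrDr /=.
rewrite addrCA; congr (_ + _); rewrite -mulr_sumr.
case: j {E} => [|j] /=.
  rewrite big1; last by move=> i _; rewrite mulr0.
  by rewrite elsym_zero mulr0 addr0 mul1r mulr1.
by rewrite IH // -[j.+2%:R]natr1; ring.
Qed.

Lemma elsym_one x A : elsym x A 1 = \sum_(p in A) x p.
Proof.
rewrite -[LHS]mul1r -(elsym_sum x A 0).
by apply: eq_bigr => p _; rewrite elsym_zero mulr1.
Qed.

Lemma pelsym_sum x A j :
  \sum_(p in A) x p * pelsym x (A :\ p) j = j%:R * elsym x A j.
Proof.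
case: j => [|j] /=; last exact: elsym_sum.
by rewrite big1 ?mul0r // => i _; rewrite mulr0.
Qed.

(** The first derivative of [elsym] in the direction [u].  Next to it [d2elsym] is
the second derivative as a bilinear form; it has no diagonal terms because
[elsym] is affine in each variable. *)
Definition delsym x A j (u : T -> R) : R := \sum_(p in A) u p * pelsym x (A :\ p) j.

Definition pdelsym x A j u : R := if j is i.+1 then delsym x A i u else 0.

Definition d2elsym x A j (u v : T -> R) : R :=
  \sum_(p in A) u p * pdelsym x (A :\ p) j v.

Lemma exchange_setD1 A (F : T -> T -> R) :
  \sum_(p in A) \sum_(q in A :\ p) F p q = \sum_(q in A) \sum_(p in A :\ q) F p q.
Proof.
rewrite (exchange_big_dep (mem A)) /=; last by move=> p q _ /setD1P[].
by apply: eq_bigr => q qA; apply: eq_bigl => p; rewrite !inE qA andbT eq_sym andbC.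
Qed.

Lemma delsym_euler x A j u :
  \sum_(p in A) x p * delsym x (A :\ p) j u = j%:R * delsym x A j.+1 u.
Proof.
rewrite /delsym; under eq_bigr do rewrite mulr_sumr.
rewrite exchange_setD1 mulr_sumr; apply: eq_bigr => q _.
rewrite mulrCA -pelsym_sum mulr_sumr; apply: eq_bigr => p _.
by rewrite mulrCA setD1C.
Qed.

Lemma delsym0 x A u : delsym x A 0 u = 0.
Proof. by rewrite /delsym big1 // => p _; rewrite mulr0. Qed.

Lemma d2elsym0 x A u v : d2elsym x A 0 u v = 0.
Proof. by rewrite /d2elsym big1 // => p _; rewrite mulr0. Qed.

Lemma d2elsym1 x A u v : d2elsym x A 1 u v = 0.
Proof. by rewrite /d2elsym big1 // => p _; rewrite /= delsym0 mulr0. Qed.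

Lemma d2elsymC x A j u v : d2elsym x A j u v = d2elsym x A j v u.
Proof.
case: j => [|j]; first by rewrite !d2elsym0.
rewrite /d2elsym /= /delsym; under eq_bigr do rewrite mulr_sumr.
rewrite exchange_setD1; apply: eq_bigr => q _; rewrite mulr_sumr.
by apply: eq_bigr => p _; rewrite mulrCA setD1C.
Qed.

Lemma delsymD x A j u v : delsym x A j (fun p => u p + v p) = delsym x A j u + delsym x A j v.
Proof. by rewrite /delsym -big_split; apply: eq_bigr => p _; rewrite mulrDl. Qed.

Lemma delsymZ x A j c u : delsym x A j (fun p => c * u p) = c * delsym x A j u.
Proof. by rewrite /delsym mulr_sumr; apply: eq_bigr => p _; rewrite mulrA. Qed.

Lemma d2elsymD x A j u v w :
  d2elsym x A j (fun p => u p + v p) w = d2elsym x A j u w + d2elsym x A j v w.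
Proof. by rewrite /d2elsym -big_split; apply: eq_bigr => p _; rewrite mulrDl. Qed.

Lemma d2elsymZ x A j c u w :
  d2elsym x A j (fun p => c * u p) w = c * d2elsym x A j u w.
Proof. by rewrite /d2elsym mulr_sumr; apply: eq_bigr => p _; rewrite mulrA. Qed.

Lemma delsym_id x A j : delsym x A j x = j%:R * elsym x A j.
Proof. exact: pelsym_sum. Qed.

(** The direction [x^2] raises the degree by one: this identity is behind both
Newton's inequalities and the computations with the vector [x - x^2]. *)
Lemma delsym_sqr x A j :
  delsym x A j (fun p => x p ^+ 2) =
  elsym x A 1 * elsym x A j - j.+1%:R * elsym x A j.+1.
Proof.
have E p : p \in A -> x p ^+ 2 * pelsym x (A :\ p) j =
   x p * elsym x A j - x p * elsym x (A :\ p) j.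
  by move=> pA; rewrite (elsym_rem x j pA) mulrDr addrC addKr mulrA.
by rewrite /delsym (eq_bigr _ E) sumrB -mulr_suml elsym_sum elsym_one.
Qed.

Lemma d2elsym_id x A j v : d2elsym x A j.+1 x v = j%:R * delsym x A j.+1 v.
Proof.
rewrite d2elsymC /d2elsym /= /delsym mulr_sumr; apply: eq_bigr => p _ /=.
by rewrite -/(delsym _ _ _ _) delsym_id mulrCA.
Qed.

Lemma d2elsym_sqr x A j v :
  d2elsym x A j.+1 (fun p => x p ^+ 2) v =
  elsym x A 1 * delsym x A j.+1 v - \sum_(p in A) x p * v p * elsym x (A :\ p) j
  - j.+1%:R * delsym x A j.+2 v.
Proof.
rewrite d2elsymC /d2elsym /= {3}/delsym mulr_sumr {2}/delsym mulr_sumr -!sumrB.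
apply: eq_bigr => p pA; rewrite delsym_sqr /= (elsym_rem x 1 pA) /= elsym_zero.
by ring.
Qed.

End ElementarySymmetric.

(** * Newton's inequalities and the Garding cone *)

Lemma elsym_rmorph (R S : comNzRingType) (f : {rmorphism R -> S}) (T : finType)
    (x : T -> R) (A : {set T}) j : f (elsym x A j) = elsym (f \o x) A j.
Proof.
rewrite /elsym -coef_map rmorph_prod /=; congr (polyseq _)`_j.
by apply: eq_bigr => p _; rewrite rmorphD rmorph1 /= map_polyZ map_polyX.
Qed.

Section Newton.
Variables (R : realFieldType) (T : finType).
Implicit Types (x : T -> R) (A : {set T}) (j k : nat).

Lemma newton_rem x A p j : p \in A ->
  elsym x A j * elsym x (A :\ p) j - elsym x A j.+1 * pelsym x (A :\ p) j =
  elsym x (A :\ p) j ^+ 2 - pelsym x (A :\ p) j * elsym x (A :\ p) j.+1.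
Proof.
by move=> pA; rewrite (elsym_rem x j pA) (elsym_rem x j.+1 pA) /=; ring.
Qed.

(** The two sides are the derivative of [sigma_{j+1} / sigma_j] in the direction
[x^2], up to the factor [sigma_j^2].  The summands on the right are Newton
differences of lower degree in fewer variables, so that the inequalities follow
by induction, with no condition on signs. *)
Lemma newton_identity x A j :
  j.+1%:R * elsym x A j.+1 ^+ 2 - j.+2%:R * (elsym x A j * elsym x A j.+2) =
  \sum_(p in A) x p ^+ 2 *
    (elsym x (A :\ p) j ^+ 2 - pelsym x (A :\ p) j * elsym x (A :\ p) j.+1).
Proof.
under eq_bigr => p pA do rewrite -newton_rem // mulrBr (mulrCA (_ ^+ 2))
  (mulrCA (_ ^+ 2) (elsym x A j.+1)).
rewrite sumrB -!mulr_sumr.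
have := delsym_sqr x A j.+1; have := delsym_sqr x A j.
by rewrite /delsym => -> ->; ring.
Qed.

Lemma newton_weak x A j :
  pelsym x A j * elsym x A j.+1 <= elsym x A j ^+ 2.
Proof.
elim: j A => [|j IH] A; first by rewrite mul0r sqr_ge0.
have : 0 <= j.+1%:R * elsym x A j.+1 ^+ 2 - j.+2%:R * (elsym x A j * elsym x A j.+2).
  rewrite newton_identity; apply: sumr_ge0 => p _.
  by rewrite mulr_ge0 ?sqr_ge0 // subr_ge0.
rewrite subr_ge0 /= => H; rewrite -(ler_pM2l (ltr0Sn R j.+1)).
by apply: le_trans H _; rewrite ler_wpM2r ?sqr_ge0 // ler_nat.
Qed.

Lemma newton x A j :
  j.+1%:R * (pelsym x A j * elsym x A j.+1) <= j%:R * elsym x A j ^+ 2.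
Proof.
case: j => [|j]; first by rewrite !mul0r mulr0.
rewrite -subr_ge0 newton_identity; apply: sumr_ge0 => p _.
by rewrite mulr_ge0 ?sqr_ge0 // subr_ge0 newton_weak.
Qed.

End Newton.

(** Newton's inequality for [x] with an additional variable [a].  With [a] free it
relates four consecutive elementary symmetric polynomials. *)
Lemma newton_augmented (R : realFieldType) (T : finType) (x : T -> R)
    (A : {set T}) a j :
  (elsym x A j + a * pelsym x A j) * (elsym x A j.+2 + a * elsym x A j.+1) <=
  (elsym x A j.+1 + a * elsym x A j) ^+ 2.
Proof.
pose x' (o : option T) := if o is Some i then x i else a.
have E i : elsym x' (None |: Some @: A) i = elsym x A i + a * pelsym x A i.
  have NA : None \notin Some @: A by apply/imsetP => -[].
  have F l : elsym x' (Some @: A) l = elsym x A l.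
    by rewrite /elsym big_imset //= => p q _ _ [].
  rewrite (elsym_rem x' i (setU11 None _)) setU1K // F.
  by case: i => //= i; rewrite F.
by have := newton_weak x' (None |: Some @: A) j.+1; rewrite /= !E.
Qed.

Section Cone.
Variables (R : realFieldType) (T : finType).
Implicit Types (x : T -> R) (A : {set T}) (j k : nat).

Definition gcone x A k := forall j, (j <= k)%N -> 0 < elsym x A j.

Lemma gcone_leq x A j k : (j <= k)%N -> gcone x A k -> gcone x A j.
Proof. by move=> jk H i ij; apply: H; apply: leq_trans jk. Qed.

Lemma gcone_pelsym x A j k : gcone x A k -> (j <= k.+1)%N -> 0 <= pelsym x A j.
Proof. by case: j => //= j H /H/ltW. Qed.

(** If the first nonpositive polynomial without [x_p] had degree [j + 1], then
positivity of the polynomials of degrees [j + 1] and [j + 2] in all the variables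
would contradict Newton's inequality. *)
Lemma gcone_rem x A p k : p \in A -> gcone x A k.+1 -> gcone x (A :\ p) k.
Proof.
move=> pA H j; elim: j => [|j IH] jk; first by rewrite elsym_zero.
have {IH} b0 := IH (ltnW jk).
have := H j.+1 (leqW jk); have := H j.+2 jk; rewrite !(elsym_rem _ _ pA) /=.
have := newton_weak x (A :\ p) j.+1 => /=.
move: (elsym _ _ j) b0 (elsym _ _ j.+1) (elsym _ _ j.+2) (x p) => b b0 c d m N2 N1 N0.
rewrite ltNge; apply/negP => c0.
have [m0|m0] := lerP m 0; first by nra.
have bd : b * (d + m * c) > 0 by rewrite mulr_gt0.
have := mulr_ge0_le0 (ltW N0) c0.
by nra.
Qed.

End Cone.

(** * Second order jets of quotients *)

Ltac pos := repeat first
  [ assumption | apply: sqr_ge0 | apply: exprn_ge0 | apply: addr_ge0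
  | apply: mulr_ge0 | apply: divr_ge0 | rewrite invr_ge0 ].

Section Jets.
Variables (R : realFieldType).
Implicit Types (n d c : {poly R}) (D : R).

(** For polynomials [n] and [d] in a time parameter, [jet0], [jet1] and [jet2] are
the Taylor coefficients of [n / d] at 0 of orders 0, 1 and 2. *)
Definition jet0 n d : R := n`_0 / d`_0.
Definition jet1 n d : R := (n`_1 - jet0 n d * d`_1) / d`_0.
Definition jet2 n d : R := (n`_2 - jet0 n d * d`_2 - jet1 n d * d`_1) / d`_0.

(** A quantitative concavity at time 0: for [y = n / d] it says [2 y'^2 <= - D y''],
with [D >= 0] and [y'' <= 0]. *)
Definition jet_bound D n d :=
  [/\ 0 <= D, jet2 n d <= 0 & jet1 n d ^+ 2 <= D * - jet2 n d].

Lemma sqr_add_le (a b D E y z : R) : 0 <= D -> 0 <= E -> 0 <= y -> 0 <= z ->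
  a ^+ 2 <= D * y -> b ^+ 2 <= E * z -> (a + b) ^+ 2 <= (D + E) * (y + z).
Proof.
move=> D0 E0 y0 z0 ha hb.
suff : 2 * (a * b) <= D * z + E * y by move: ha hb; nra.
have X0 : 0 <= D * z + E * y by nra.
have : (2 * (a * b)) ^+ 2 <= (D * z + E * y) ^+ 2.
  have : a ^+ 2 * b ^+ 2 <= D * y * (E * z) by rewrite ler_pM ?sqr_ge0.
  by have := sqr_ge0 (D * z - E * y); nra.
by move=> H; rewrite leNgt; apply/negP => K; move: H; rewrite leNgt ltrXn2r ?K.
Qed.

Lemma jet0_add n n' d : jet0 (n + n') d = jet0 n d + jet0 n' d.
Proof. by rewrite /jet0 coefD mulrDl. Qed.

Lemma jet1_add n n' d : jet1 (n + n') d = jet1 n d + jet1 n' d.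
Proof. by rewrite /jet1 jet0_add coefD; ring. Qed.

Lemma jet2_add n n' d : jet2 (n + n') d = jet2 n d + jet2 n' d.
Proof. by rewrite /jet2 jet0_add jet1_add coefD; ring. Qed.

Lemma jet_bound0 d : jet_bound 0 0 d.
Proof.
rewrite /jet_bound /jet2 /jet1 /jet0 !coef0 !(mul0r, mulr0, subrr, oppr0).
by rewrite expr0n.
Qed.

Lemma jet_bound_sum (I : finType) (A : {set I}) (D : I -> R) (n : I -> {poly R}) d :
  (forall p, p \in A -> jet_bound (D p) (n p) d) ->
  jet_bound (\sum_(p in A) D p) (\sum_(p in A) n p) d.
Proof.
move=> H; apply: (big_ind2 (fun D n => jet_bound D n d)) => //.
  exact: jet_bound0.
move=> D1 n1 D2 n2 [D10 q1 h1] [D20 q2 h2]; split; first exact: addr_ge0.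
  by rewrite jet2_add; lra.
by rewrite jet1_add jet2_add opprD; apply: sqr_add_le; rewrite ?oppr_ge0.
Qed.

Lemma jet_bound_scale D n d (l : R) : 0 < l ->
  jet_bound D (l *: n) d -> jet_bound (D / l) n d.
Proof.
move=> l0 [D0].
have E0 : jet0 (l *: n) d = l * jet0 n d by rewrite /jet0 coefZ mulrA.
have E1 : jet1 (l *: n) d = l * jet1 n d by rewrite /jet1 E0 coefZ; ring.
have E2 : jet2 (l *: n) d = l * jet2 n d by rewrite /jet2 E0 E1 coefZ; ring.
rewrite E1 E2 => q h; split; first by rewrite divr_ge0 // ltW.
  by move: q; rewrite pmulr_rle0.
have -> : D / l * - jet2 n d = D * - (l * jet2 n d) / l ^+ 2.
  by field; rewrite gt_eqF.
by rewrite ler_pdivlMr ?exprn_gt0 // mulrC -exprMn.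
Qed.

(** The Cauchy-Schwarz inequality behind [jet_bound_parallel].  The right factor is
for [e > 0] a positive definite binary quadratic form in [g u] and [m g1] once [b]
is replaced by its lower bound [g1^2 / e], and the left side is the square of a
linear form. *)
Lemma parallel_sum_bound (m w u g e g1 b : R) :
  0 < w -> 0 <= e -> 0 < m + g -> 0 <= b -> g1 ^+ 2 <= e * b ->
  (g ^+ 2 * u + m ^+ 2 * g1) ^+ 2 * (m + g + w + e) <=
  (w * g ^+ 2 + e * m ^+ 2 + w * e * (m + g)) *
  ((m + g) * (g ^+ 2 * (u ^+ 2 / w) + m ^+ 2 * b) + (g * u - m * g1) ^+ 2).
Proof.
move=> w0; rewrite le_eqVlt => /orP[/eqP<-|e0] S0 b0 hb.
  have g10 : g1 = 0.
    by apply/eqP; rewrite -sqrf_eq0 eq_le sqr_ge0 (le_trans hb) // mul0r.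
  have -> : (w * g ^+ 2 + 0 * m ^+ 2 + w * 0 * (m + g)) *
  ((m + g) * (g ^+ 2 * (u ^+ 2 / w) + m ^+ 2 * b) + (g * u - m * g1) ^+ 2)
   = (g ^+ 2 * u) ^+ 2 * (m + g + w) + w * g ^+ 2 * (m + g) * m ^+ 2 * b.
    by rewrite g10; field; rewrite gt_eqF.
  rewrite g10 mulr0 !addr0 lerDl.
  have := ltW S0; have := ltW w0 => ? ?.
  by pos.
have hb' : g1 ^+ 2 / e <= b by rewrite ler_pdivrMr // mulrC.
apply: le_trans (_ : (w * g ^+ 2 + e * m ^+ 2 + w * e * (m + g)) *
  ((m + g) * (g ^+ 2 * (u ^+ 2 / w) + m ^+ 2 * (g1 ^+ 2 / e)) +
   (g * u - m * g1) ^+ 2) <= _).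
  have X : 0 <= (m + g) * (g * u * (m + w) * e - m * g1 * (g + e) * w) ^+ 2 / (w * e).
    by have := ltW S0; have := ltW w0; have := ltW e0 => ? ? ?; pos.
  rewrite -subr_ge0; apply: le_trans X _; rewrite le_eqVlt; apply/orP; left.
  by apply/eqP; field; rewrite !gt_eqF.
rewrite ler_wpM2l //; last first.
  rewrite lerD2r ler_pM2l // lerD2l ler_wpM2l ?sqr_ge0 //.
have := ltW S0; have := ltW w0; have := ltW e0 => ? ? ?.
by pos.
Qed.

(** Parallel sums [y z / (y + z)] preserve [jet_bound].  If [L] and [M] are the values
of [y] and [z] increased by their constants, then the constant of the parallel
sum is the increase of the parallel sum when its arguments go to [L] and [M];
this form of the constant makes it propagate through [jet_bound_quot]. *)
Lemma jet_bound_parallel c n d (m w u e : R) :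
  c`_0 = m -> c`_1 = u -> c`_2 = - (u ^+ 2 / w) -> 0 < w -> 0 < d`_0 ->
  0 < m + jet0 n d -> jet_bound e n d ->
  jet_bound ((m + w) * (jet0 n d + e) / (m + w + (jet0 n d + e))
             - m * jet0 n d / (m + jet0 n d))
    (c * n) (n + c * d).
Proof.
move=> c0 c1 c2 w0 d0 S0 [e0 q h].
set g := jet0 n d in S0 *; set g1 := jet1 n d in h; set g2 := jet2 n d in h q.
have dn0 : d`_0 != 0 by rewrite gt_eqF.
have n0E : n`_0 = g * d`_0 by rewrite /g /jet0; field.
have n1E : n`_1 = g * d`_1 + g1 * d`_0 by rewrite /g1 /jet1 -/g; field.
have n2E : n`_2 = g * d`_2 + g1 * d`_1 + g2 * d`_0.
  by rewrite /g2 /jet2 -/g -/g1; field.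
have M0 (p r : {poly R}) : (p * r)`_0 = p`_0 * r`_0.
  by rewrite coefM big_ord1.
have M1 (p r : {poly R}) : (p * r)`_1 = p`_0 * r`_1 + p`_1 * r`_0.
  by rewrite coefM !big_ord_recl big_ord0 addr0.
have M2 (p r : {poly R}) : (p * r)`_2 = p`_0 * r`_2 + p`_1 * r`_1 + p`_2 * r`_0.
  by rewrite coefM !big_ord_recl big_ord0 addr0 addrA.
have Sn0 : m + g != 0 by rewrite gt_eqF.
have wn0 : w != 0 by rewrite gt_eqF.
have S20 : 0 < m + w + (g + e) by lra.
have S2n0 : m + w + (g + e) != 0 by rewrite gt_eqF.
have Dn0 : g * d`_0 + m * d`_0 != 0 by rewrite -mulrDl mulf_neq0 // addrC.
have J0 : jet0 (c * n) (n + c * d) = m * g / (m + g).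
  by rewrite /jet0 coefD !M0 n0E c0; field; rewrite ?dn0 ?Sn0 ?Dn0.
have J1 : jet1 (c * n) (n + c * d) = (g ^+ 2 * u + m ^+ 2 * g1) / (m + g) ^+ 2.
  rewrite /jet1 J0 !coefD !M1 !M0 n0E n1E c0 c1.
  by field; rewrite ?dn0 ?Sn0 ?Dn0.
have J2 : jet2 (c * n) (n + c * d) =
  - (((m + g) * (g ^+ 2 * (u ^+ 2 / w) + m ^+ 2 * - g2) + (g * u - m * g1) ^+ 2)
     / (m + g) ^+ 3).
  rewrite /jet2 J0 J1 !coefD !M2 !M1 !M0 n0E n1E n2E c0 c1 c2.
  by field; rewrite wn0 Sn0 Dn0.
have DE : (m + w) * (g + e) / (m + w + (g + e)) - m * g / (m + g) =
  (w * g ^+ 2 + e * m ^+ 2 + w * e * (m + g)) / ((m + g) * (m + w + (g + e))).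
  by field; rewrite ?Sn0 ?S2n0.
have b0 : 0 <= - g2 by rewrite oppr_ge0.
have := ltW S0; have := ltW w0; have := ltW S20 => S20' w0' S0'.
rewrite /jet_bound J1 J2 DE; split.
- by pos.
- by rewrite oppr_le0; pos.
have := @parallel_sum_bound m w u g e g1 (- g2) w0 e0 S0 b0 h.
set X := _ + m ^+ 2 * g1; set Y := _ * (_ + _) => H.
rewrite opprK mulf_div expr_div_n.
rewrite ler_pdivrMr; last by rewrite !exprn_gt0.
have -> : Y / ((m + g) * (m + w + (g + e)) * (m + g) ^+ 3) * (m + g) ^+ 2 ^+ 2 =
  Y / (m + w + (g + e)) by field; rewrite ?S2n0 ?Sn0.
rewrite ler_pdivlMr //; apply: le_trans _ H.
by rewrite le_eqVlt; apply/orP; left; apply/eqP; ring.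
Qed.
End Jets.

(** * Elementary symmetric polynomials along a parabola *)

Section PolynomialCurves.
Variables (R : realFieldType) (T : finType).
Implicit Types (c : T -> {poly R}) (A : {set T}) (j : nat).

Lemma deriv_elsym c A j :
  (elsym c A j)^`() = delsym c A j (fun p => (c p)^`()).
Proof.
elim: j A => [|j IH] A; first by rewrite elsym_zero delsym0 derivC.
apply: (@mulfI _ (j.+1%:R : {poly R})).
  by rewrite -(rmorph_nat polyC) polyC_eq0 pnatr_eq0.
rewrite mulr_natl -derivMn -(mulr_natl (elsym c A j.+1)) -elsym_sum raddf_sum /=.
under eq_bigr do rewrite derivM IH.
rewrite big_split /= delsym_euler -(nat1r j) mulrDl mul1r; congr (_ + _).
Qed.

Lemma deriv_pelsym c A j :
  (pelsym c A j)^`() = pdelsym c A j (fun p => (c p)^`()).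
Proof. by case: j => [|j] /=; rewrite ?deriv0 ?deriv_elsym. Qed.

Lemma deriv_delsym c A j u :
  (delsym c A j u)^`() =
  delsym c A j (fun p => (u p)^`()) + d2elsym c A j u (fun p => (c p)^`()).
Proof.
rewrite /delsym raddf_sum /= -big_split; apply: eq_bigr => p _.
by rewrite derivM deriv_pelsym.
Qed.

Lemma horner_elsym c A j (a : R) :
  (elsym c A j).[a] = elsym (fun p => (c p).[a]) A j.
Proof. exact: (elsym_rmorph (horner_eval a)). Qed.

Lemma horner_delsym c A j u (a : R) :
  (delsym c A j u).[a] = delsym (fun p => (c p).[a]) A j (fun p => (u p).[a]).
Proof.
rewrite /delsym horner_sum; apply: eq_bigr => p _; rewrite hornerM.
by case: j => [|j] /=; rewrite ?horner0 // horner_elsym.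
Qed.

Lemma horner_d2elsym c A j u v (a : R) :
  (d2elsym c A j u v).[a] =
  d2elsym (fun p => (c p).[a]) A j (fun p => (u p).[a]) (fun p => (v p).[a]).
Proof.
rewrite /d2elsym horner_sum; apply: eq_bigr => p _; rewrite hornerM.
by case: j => [|j] /=; rewrite ?horner0 // horner_delsym.
Qed.

Lemma eq_delsym (x y u v : T -> R) A j : x =1 y -> u =1 v ->
  delsym x A j u = delsym y A j v.
Proof.
move=> xy uv; apply: eq_bigr => p _; rewrite uv; congr (_ * _).
by case: j => //= j; apply: eq_elsym => q _.
Qed.

Lemma eq_d2elsym (x y u v u' v' : T -> R) A j : x =1 y -> u =1 v -> u' =1 v' ->
  d2elsym x A j u u' = d2elsym y A j v v'.
Proof.
move=> xy uv uv'; apply: eq_bigr => p _; rewrite uv; congr (_ * _).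
by case: j => //= j; apply: eq_delsym.
Qed.

Variables (x u t : T -> R).

(** The quadratic term is free: it will encode the diagonal terms of the quadratic
forms, as a change of the second derivative by [- 2 t]. *)
Definition curve p : {poly R} := (x p)%:P + u p *: 'X - t p *: 'X^2.

Lemma curve_coef p : [/\ (curve p)`_0 = x p, (curve p)`_1 = u p & (curve p)`_2 = - t p].
Proof.
by rewrite /curve; split; rewrite !(coefN, coefD, coefC, coefZ, coefX, coefXn) /=
  !(mulr0n, mulr1n, mulr0, mulr1, addr0, add0r, subr0, sub0r).
Qed.

Lemma elsym_curve0 A j : (elsym curve A j)`_0 = elsym x A j.
Proof.
rewrite -horner_coef0 horner_elsym; apply: eq_elsym => p _ /=.
by rewrite horner_coef0; case: (curve_coef p).
Qed.

Lemma elsym_curve1 A j : (elsym curve A j)`_1 = delsym x A j u.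
Proof.
have := coef_deriv (elsym curve A j) 0; rewrite mulr1n => <-.
rewrite -horner_coef0 deriv_elsym horner_delsym; apply: eq_delsym => p.
  by rewrite horner_coef0; case: (curve_coef p).
by rewrite horner_coef0 coef_deriv mulr1n; case: (curve_coef p).
Qed.

Lemma elsym_curve2 A j :
  2 * (elsym curve A j)`_2 = d2elsym x A j u u - 2 * delsym x A j t.
Proof.
have <- : (elsym curve A j)^`()^`()`_0 = 2 * (elsym curve A j)`_2.
  by rewrite !coef_deriv mulr1n mulr_natl.
rewrite -horner_coef0 deriv_elsym deriv_delsym hornerD horner_delsym.
rewrite horner_d2elsym addrC; congr (_ + _).
  apply: eq_d2elsym => p; rewrite horner_coef0 ?coef_deriv ?mulr1n;
    by case: (curve_coef p).
rewrite -mulrN -mulN1r mulrA mulrN1 -delsymZ; apply: eq_delsym => p.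
  by rewrite horner_coef0; case: (curve_coef p).
rewrite horner_coef0 !coef_deriv mulr1n; case: (curve_coef p) => _ _ ->.
by rewrite mulNr mulrC mulr_natr mulNrn.
Qed.
End PolynomialCurves.

(** * Concavity of the quotient of consecutive elementary symmetric polynomials *)

Section Quotient.
Variables (R : realFieldType) (T : finType).
Implicit Types (x u v w : T -> R) (A : {set T}) (j : nat).

(** For [j + 1 = k] this is the function [q] of the introduction.  The functions
[gquot], [dquot] and [d2quot] below are its partial derivatives, its
first derivative and its second derivative. *)
Definition quot x A j : R := elsym x A j.+1 / elsym x A j.

(** Induction on [j] through the Marcus-Lopes identity: [j + 2] times the quotient of
order [j + 1] is the sum over [p] of the parallel sums of [x_p] and the quotient
of order [j] without [x_p].  The constants also add up, because the identity
holds at [x + w] as well as at [x].  The curvature [u_p^2 / w_p] gives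
equality for a single variable. *)
Lemma jet_bound_quot x u w A j :
  (forall p, p \in A -> 0 < w p) -> gcone x A j ->
  gcone (fun p => x p + w p) A j ->
  let c := curve x u (fun p => u p ^+ 2 / w p) in
  jet_bound (quot (fun p => x p + w p) A j - quot x A j)
    (elsym c A j.+1) (elsym c A j).
Proof.
move=> w0 xA LA c; set L := fun p => x p + w p in LA *.
elim: j A w0 xA LA => [|j IH] A w0 xA LA.
  rewrite /quot !elsym_zero !elsym_one !divr1 -sumrB; apply: jet_bound_sum => p pA.
  rewrite /L addrC addKr /jet_bound /jet2 /jet1 /jet0 coef1 /= !coef1 /=.
  rewrite !(mulr0, subr0, divr1); case: (curve_coef x u (fun p => u p ^+ 2 / w p) p).
  move=> _ -> ->; have wp := w0 p pA; split; first exact: ltW.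
    by rewrite oppr_le0 divr_ge0 ?sqr_ge0 // ltW.
  by rewrite opprK mulrC divfK // gt_eqF.
have step z (p : T) : p \in A -> gcone z A j.+1 ->
    z p * quot z (A :\ p) j / (z p + quot z (A :\ p) j) =
    z p * elsym z (A :\ p) j.+1 / elsym z A j.+1.
  move=> pA zA; have := zA j.+1 (leqnn _); rewrite (elsym_rem z j.+1 pA) /=.
  have := gcone_rem pA zA (leqnn _); rewrite /quot => d0 e0.
  by field; rewrite ?(gt_eqF d0) ?[z p * _ + _]addrC ?(gt_eqF e0).
have qE (z : T -> R) : gcone z A j.+1 -> quot z A j.+1 =
    (\sum_(p in A) z p * quot z (A :\ p) j / (z p + quot z (A :\ p) j)) / j.+2%:R.
  move=> zA; have e0 := zA j.+1 (leqnn _).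
  rewrite (eq_bigr _ (fun p pA => step z p pA zA)) -mulr_suml elsym_sum /quot.
  by rewrite [RHS]mulrAC [_ * elsym _ _ _]mulrC mulfK ?pnatr_eq0.
rewrite (qE x xA) (qE L LA) -mulrBl; apply: jet_bound_scale; first exact: ltr0Sn.
rewrite -mul_polyC rmorph_nat -elsym_sum -sumrB; apply: jet_bound_sum => p pA.
have [c0 c1 c2] := curve_coef x u (fun p => u p ^+ 2 / w p) p.
have xp := gcone_rem pA xA; have Lp := gcone_rem pA LA.
have wp r : r \in A :\ p -> 0 < w r by move/setD1P => [_ /w0].
have q0 : quot x (A :\ p) j = jet0 (elsym c (A :\ p) j.+1) (elsym c (A :\ p) j).
  by rewrite /jet0 !elsym_curve0.
rewrite (elsym_rem c j.+1 pA) /=.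
have := jet_bound_parallel c0 c1 c2 (w0 p pA) _ _ (IH _ wp xp Lp).
rewrite -q0 (addrC (quot x _ _)) subrK elsym_curve0; apply.
  exact: xp.
have := xA j.+1 (leqnn _); rewrite (elsym_rem x j.+1 pA) /=.
have b0 := xp j (leqnn _); rewrite /quot => H.
by rewrite -(pmulr_lgt0 _ b0) mulrDl divfK ?gt_eqF // addrC.
Qed.

Definition gquot x A j p : R :=
  (elsym x (A :\ p) j - quot x A j * pelsym x (A :\ p) j) / elsym x A j.

Definition dquot x A j u : R :=
  (delsym x A j.+1 u - quot x A j * delsym x A j u) / elsym x A j.

Definition d2quot x A j u v : R :=
  (d2elsym x A j.+1 u v - quot x A j * d2elsym x A j u v
   - dquot x A j u * delsym x A j v - dquot x A j v * delsym x A j u) / elsym x A j.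

(** Minus the second derivative of [quot], increased by diagonal terms.  For
[w = 1 - x] it is minus the second derivative with respect to the coordinates
[1 / (1 - x_p)]. *)
Definition weighted_hess x w A j u v : R :=
  2 * (\sum_(p in A) gquot x A j p * (u p * v p) / w p) - d2quot x A j u v.

Lemma dquotE x A j u : dquot x A j u = \sum_(p in A) u p * gquot x A j p.
Proof.
rewrite /dquot /gquot /delsym mulr_sumr -sumrB mulr_suml; apply: eq_bigr => p _ /=.
by ring.
Qed.

(** The partial derivative is a Newton difference of the remaining variables. *)
Lemma gquot_ge0 x A j p : p \in A -> 0 <= gquot x A j p.
Proof.
move=> pA; have [e0|e0] := eqVneq (elsym x A j) 0.
  by rewrite /gquot e0 invr0 mulr0.
have -> : gquot x A j p = (elsym x (A :\ p) j ^+ 2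
   - pelsym x (A :\ p) j * elsym x (A :\ p) j.+1) / elsym x A j ^+ 2.
  by rewrite -newton_rem // /gquot /quot; field.
by rewrite divr_ge0 ?sqr_ge0 // subr_ge0 newton_weak.
Qed.

Lemma quot_concave x w A j u :
  (forall p, p \in A -> 0 < w p) -> gcone x A j ->
  gcone (fun p => x p + w p) A j ->
  [/\ quot x A j <= quot (fun p => x p + w p) A j,
      0 <= weighted_hess x w A j u u &
      2 * dquot x A j u ^+ 2 <=
      (quot (fun p => x p + w p) A j - quot x A j) * weighted_hess x w A j u u].
Proof.
move=> w0 xA LA; have [D0] := jet_bound_quot u w0 xA LA.
have e0 : elsym x A j != 0 by rewrite gt_eqF // xA.
set c := curve _ _ _; set n := elsym c A j.+1; set d := elsym c A j.
have J0 : jet0 n d = quot x A j by rewrite /jet0 !elsym_curve0.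
have J1 : jet1 n d = dquot x A j u by rewrite /jet1 J0 !elsym_curve1 elsym_curve0.
have J2 : jet2 n d = - (weighted_hess x w A j u u / 2).
  have T2 : \sum_(p in A) gquot x A j p * (u p * u p) / w p =
      dquot x A j (fun p => u p ^+ 2 / w p).
    by rewrite dquotE; apply: eq_bigr => p _; ring.
  rewrite /weighted_hess T2 /d2quot {2}/dquot /jet2 J0 J1 elsym_curve1 elsym_curve0.
  have := elsym_curve2 x u (fun p => u p ^+ 2 / w p) A j.+1.
  have := elsym_curve2 x u (fun p => u p ^+ 2 / w p) A j.
  rewrite -/c -/n -/d => H1 H2.
  have {H1}-> : d`_2 = (d2elsym x A j u u
      - 2 * delsym x A j (fun p => u p ^+ 2 / w p)) / 2 by rewrite -H1; field.
  have {H2}-> : n`_2 = (d2elsym x A j.+1 u u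
      - 2 * delsym x A j.+1 (fun p => u p ^+ 2 / w p)) / 2 by rewrite -H2; field.
  by rewrite /dquot; field.
rewrite J1 J2 => H2 H1; rewrite subr_ge0 in D0; split => //; first by lra.
by rewrite opprK in H1; lra.
Qed.

Lemma dquotD x A j u v : dquot x A j (fun p => u p + v p) = dquot x A j u + dquot x A j v.
Proof. by rewrite /dquot !delsymD; ring. Qed.

Lemma dquotZ x A j a u : dquot x A j (fun p => a * u p) = a * dquot x A j u.
Proof. by rewrite /dquot !delsymZ; ring. Qed.

Lemma d2quotC x A j u v : d2quot x A j u v = d2quot x A j v u.
Proof. by rewrite /d2quot (d2elsymC _ _ _ u) (d2elsymC _ _ j u); ring. Qed.

Lemma d2quotD x A j u v z :
  d2quot x A j (fun p => u p + v p) z = d2quot x A j u z + d2quot x A j v z.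
Proof. by rewrite /d2quot !d2elsymD dquotD !delsymD; ring. Qed.

Lemma d2quotZ x A j a u z :
  d2quot x A j (fun p => a * u p) z = a * d2quot x A j u z.
Proof. by rewrite /d2quot !d2elsymZ dquotZ !delsymZ; ring. Qed.

Lemma weighted_hessC x w A j u v : weighted_hess x w A j u v = weighted_hess x w A j v u.
Proof.
rewrite /weighted_hess d2quotC; congr (_ * _ - _); apply: eq_bigr => p _.
by rewrite (mulrC (u p)).
Qed.

Lemma weighted_hessD x w A j u v z :
  weighted_hess x w A j (fun p => u p + v p) z =
  weighted_hess x w A j u z + weighted_hess x w A j v z.
Proof.
rewrite /weighted_hess d2quotD (_ : \sum_(p in A) _ =
  \sum_(p in A) gquot x A j p * (u p * z p) / w p +
  \sum_(p in A) gquot x A j p * (v p * z p) / w p); first by ring.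
by rewrite -big_split; apply: eq_bigr => p _ /=; ring.
Qed.

Lemma weighted_hessZ x w A j a u z :
  weighted_hess x w A j (fun p => a * u p) z = a * weighted_hess x w A j u z.
Proof.
rewrite /weighted_hess d2quotZ (_ : \sum_(p in A) _ =
  a * \sum_(p in A) gquot x A j p * (u p * z p) / w p); first by ring.
by rewrite mulr_sumr; apply: eq_bigr => p _ /=; ring.
Qed.

(** The form is positive semidefinite by [quot_concave]. *)
Lemma weighted_hess_cauchy_schwarz x w A j u v :
  (forall p, p \in A -> 0 < w p) -> gcone x A j ->
  gcone (fun p => x p + w p) A j ->
  weighted_hess x w A j u v ^+ 2 <= weighted_hess x w A j u u * weighted_hess x w A j v v.
Proof.
move=> w0 xA LA.
have P a b : 0 <= a ^+ 2 * weighted_hess x w A j u u + 2 * (a * b) * weighted_hess x w A j u v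
              + b ^+ 2 * weighted_hess x w A j v v.
  have [_ + _] := quot_concave (fun p => a * u p + b * v p) w0 xA LA.
  have E t : weighted_hess x w A j t (fun p => a * u p + b * v p) =
      a * weighted_hess x w A j t u + b * weighted_hess x w A j t v.
    by rewrite weighted_hessC weighted_hessD !weighted_hessZ !(weighted_hessC _ _ _ _ t).
  rewrite weighted_hessD !weighted_hessZ !E (weighted_hessC _ _ _ _ v u).
  by move=> H; apply: le_trans H _; rewrite le_eqVlt; apply/orP; left; apply/eqP; ring.
move: P; move: (weighted_hess x w A j u u) (weighted_hess x w A j u v) (weighted_hess x w A j v v).
move=> a b c P.
have c0 : 0 <= c by have := P 0 1; rewrite !(expr0n, mul0r, mulr0, expr1n) /=; lra.
have a0 : 0 <= a by have := P 1 0; rewrite !(expr0n, mul0r, mulr0, expr1n) /=; lra.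
have [c1|c1] := ltrP 0 c.
  by have := P c (- b); nra.
have {c1}c0 : c = 0 by apply/eqP; rewrite eq_le c1.
subst c; rewrite mulr0; have := P b (- (a + 1)); nra.
Qed.

End Quotient.

(** * Translation along the vector of ones *)

Lemma elsym_rem_sum (R : comNzRingType) (T : finType) (x : T -> R) (A : {set T}) j :
  \sum_(p in A) elsym x (A :\ p) j = #|A|%:R * elsym x A j - j%:R * elsym x A j.
Proof.
have E p : p \in A -> elsym x (A :\ p) j = elsym x A j - x p * pelsym x (A :\ p) j.
  by move=> pA; rewrite (elsym_rem x j pA) addrK.
by rewrite (eq_bigr _ E) sumrB pelsym_sum sumr_const (mulr_natl _ #|A|).
Qed.

Section Shift.
Variables (R : realFieldType) (T : finType).
Implicit Types (x : T -> R) (A : {set T}) (j k : nat) (t : R).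

(** The line through [x] in the direction of the vector of ones. *)
Definition diag_line x p : {poly R} := (x p)%:P + 'X.

Lemma elsym_lineE x A j t :
  (elsym (diag_line x) A j).[t] = elsym (fun p => x p + t) A j.
Proof.
by rewrite horner_elsym; apply: eq_elsym => p _; rewrite /diag_line hornerD hornerC hornerX.
Qed.

Lemma elsym_line0 x A j : (elsym (diag_line x) A j)`_0 = elsym x A j.
Proof.
by rewrite -horner_coef0 elsym_lineE; apply: eq_elsym => p _; rewrite addr0.
Qed.

Lemma elsym_lineS x A j i :
  (elsym (diag_line x) A j.+1)`_i.+1 *+ i.+1 =
  \sum_(p in A) (elsym (diag_line x) (A :\ p) j)`_i.
Proof.
rewrite -coef_deriv deriv_elsym /delsym coef_sum; apply: eq_bigr => p _ /=.
by rewrite /diag_line derivD derivC derivX add0r mul1r.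
Qed.

(** The derivative along the line is the sum of the polynomials with one variable
removed, which stay in the cone of one order less. *)
Lemma elsym_line_coef_ge0 x A k j i : (j <= k)%N -> gcone x A k ->
  0 <= (elsym (diag_line x) A j)`_i.
Proof.
elim: i A k j => [|i IH] A k j jk xA; first by rewrite elsym_line0 ltW ?xA.
case: j jk => [|j] jk; first by rewrite elsym_zero coef1.
rewrite -(pmulrn_lge0 _ (ltn0Sn i)) elsym_lineS; apply: sumr_ge0 => p pA.
by case: k jk xA => // k jk xA; apply: (IH _ k) => //; apply: gcone_rem.
Qed.

Lemma elsym_shift_le x A k j t : (j <= k)%N -> gcone x A k -> 0 <= t ->
  elsym x A j <= elsym (fun p => x p + t) A j.
Proof.
move=> jk xA t0; rewrite -elsym_lineE (horner_coef_wide _ (leqnSn _)).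
rewrite big_ord_recl /= expr0 mulr1 elsym_line0 lerDl; apply: sumr_ge0 => i _.
by rewrite mulr_ge0 ?exprn_ge0 // (elsym_line_coef_ge0 _ jk).
Qed.

Lemma gcone_shift x A k t : gcone x A k -> 0 <= t ->
  gcone (fun p => x p + t) A k.
Proof.
by move=> xA t0 j jk; apply: lt_le_trans (xA j jk) (elsym_shift_le jk xA t0).
Qed.

(** Compare coefficients in [t]: by [elsym_lineS] and [elsym_rem_sum], that of order
[i + 1] for degree [k + 1] is at most [#|A|] times that of order [i] for degree [k]. *)
Lemma elsym_shiftS_le x A k t : gcone x A k -> 0 <= t ->
  elsym (fun p => x p + t) A k.+1 <=
  elsym x A k.+1 + t * #|A|%:R * elsym (fun p => x p + t) A k.
Proof.
move=> xA t0; rewrite -!elsym_lineE.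
set P := elsym _ A k.+1; set Q := elsym _ A k.
pose N := maxn (size P) (size Q).
rewrite (@horner_coef_wide _ N.+1 P); last by rewrite ltnW // ltnS leq_maxl.
rewrite (@horner_coef_wide _ N Q); last by rewrite leq_maxr.
rewrite big_ord_recl /= expr0 mulr1 elsym_line0 lerD2l mulr_sumr.
apply: ler_sum => i _; rewrite /bump /= add1n exprS.
have -> : t * #|A|%:R * (Q`_i * t ^+ i) = #|A|%:R * Q`_i * (t * t ^+ i) by ring.
rewrite ler_wpM2r ?mulr_ge0 ?exprn_ge0 //.
have Q0 : 0 <= Q`_i by apply: elsym_line_coef_ge0 xA.
have [P0|P0] := lerP P`_i.+1 0.
  by apply: le_trans P0 _; rewrite mulr_ge0.
apply: le_trans (_ : P`_i.+1 *+ i.+1 <= _).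
  by rewrite -mulr_natr ler_peMr ?ler1n // ltW.
rewrite elsym_lineS -coef_sum elsym_rem_sum coefB -!polyC_natr !coefCM -/Q.
by rewrite gerBl mulr_ge0.
Qed.

End Shift.

(** * Concavity of roots, Maclaurin's inequality, and the vector of ones *)

Section Bounds.
Variables (R : realFieldType) (T : finType).
Implicit Types (x u : T -> R) (A : {set T}) (j k m : nat) (t : R).

Lemma quot_gt0 x A j : gcone x A j.+1 -> 0 < quot x A j.
Proof. by move=> xA; rewrite divr_gt0 ?xA. Qed.

Lemma quot_shift_le x A j t r : gcone x A j -> 0 <= t -> 0 <= r ->
  quot x A j <= r -> quot (fun p => x p + t) A j <= r + t * #|A|%:R.
Proof.
move=> xA t0 r0; have e0 := xA j (leqnn _).
have E0 := gcone_shift xA t0 (leqnn _).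
rewrite /quot !ler_pdivrMr // => H; apply: le_trans (elsym_shiftS_le xA t0) _.
rewrite mulrDl lerD2r; apply: le_trans H _; rewrite ler_wpM2l //.
exact: elsym_shift_le xA t0.
Qed.

(** Let the weights in [quot_concave] tend to infinity: the diagonal terms disappear. *)
Lemma d2quot_le0 x A j u : gcone x A j -> d2quot x A j u u <= 0.
Proof.
move=> xA; rewrite leNgt; apply/negP => d0.
set d := d2quot x A j u u in d0.
pose C := \sum_(p in A) gquot x A j p * (u p * u p).
have C0 : 0 <= C.
  by apply: sumr_ge0 => p pA; rewrite mulr_ge0 ?gquot_ge0 // -expr2 sqr_ge0.
(* A weight for which the diagonal terms are smaller than [d]. *)
have t0 : 0 < 2 * (C + d) / d by rewrite divr_gt0 // mulr_gt0 // ltr_wpDl.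
have [_ + _] := quot_concave u (fun p _ => t0) xA (gcone_shift xA (ltW t0)).
rewrite /weighted_hess -mulr_suml -/C -/d.
have -> : 2 * (C / (2 * (C + d) / d)) - d = - (d ^+ 2 / (C + d)).
  by field; rewrite (gt_eqF d0) gt_eqF // ltr_wpDl.
by rewrite oppr_ge0 leNgt divr_gt0 ?exprn_gt0 // ltr_wpDl.
Qed.

(** This says that [sigma_{j+1}^{1/(j+1)}] is concave.  It follows by induction from
[sigma_{j+2} = q sigma_{j+1}] and the concavity of [q]; the difference of the two
sides contains a perfect square. *)
Lemma elsym_root_concave x A j u : gcone x A j.+1 ->
  j.+1%:R * (elsym x A j.+1 * d2elsym x A j.+1 u u)
  <= j%:R * delsym x A j.+1 u ^+ 2.
Proof.
elim: j => [|j IH] xA; first by rewrite d2elsym1 !mulr0 mul0r.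
have {}IH := IH (gcone_leq (leqnSn _) xA).
have := d2quot_le0 u (gcone_leq (leqnSn _) xA).
have s0 := xA j.+1 (leqnSn _); have q0 := quot_gt0 xA.
have KE : elsym x A j.+2 = quot x A j.+1 * elsym x A j.+1.
  by rewrite /quot divfK // gt_eqF.
have dKE : delsym x A j.+2 u = quot x A j.+1 * delsym x A j.+1 u
     + dquot x A j.+1 u * elsym x A j.+1.
  by rewrite /dquot divfK ?gt_eqF // addrC subrK.
rewrite /d2quot pmulr_lle0 ?invr_gt0 // KE dKE.
move: (elsym x A j.+1) (quot x A j.+1) (delsym x A j.+1 u) (dquot x A j.+1 u)
  (d2elsym x A j.+1 u u) (d2elsym x A j.+2 u u) s0 q0 IH.
move=> s q s1 d s2 K2 s0 q0 IH H.
have {}H : K2 <= q * s2 + 2 * (d * s1) by lra.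
have J0 : 0 < j.+1%:R :> R by rewrite ltr0Sn.
have J1 : j%:R = j.+1%:R - 1 :> R by rewrite -natr1 addrK.
rewrite -[j.+2%:R]natr1; rewrite J1 in IH.
move: (j.+1%:R : R) J0 IH => J J0 IH.
rewrite -(ler_pM2l J0).
apply: le_trans (_ : J * ((J + 1) * (q * s * (q * s2 + 2 * (d * s1)))) <= _).
  by rewrite !ler_pM2l // ?mulr_gt0 //; lra.
have {}IH : (J + 1) * q ^+ 2 * (J * (s * s2)) <=
    (J + 1) * q ^+ 2 * ((J - 1) * s1 ^+ 2).
  by rewrite ler_wpM2l // mulr_ge0 ?sqr_ge0 //; lra.
have X := sqr_ge0 (q * s1 - J * (d * s)).
rewrite -subr_ge0; apply: le_trans (addr_ge0 X (_ : 0 <= _)) _; last first.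
- rewrite le_eqVlt; apply/orP; left; apply/eqP.
  instantiate (1 := (J + 1) * q ^+ 2 * ((J - 1) * s1 ^+ 2) -
     (J + 1) * q ^+ 2 * (J * (s * s2))).
  by ring.
by rewrite subr_ge0.
Qed.

Lemma quot_mono x A j : gcone x A j.+1 -> quot x A j.+1 <= quot x A j.
Proof.
move=> xA; have e0 := xA j (leqnSn _); have e1 := xA j.+1 (leqnn _).
rewrite /quot ler_pdivrMr // mulrAC ler_pdivlMr // -expr2.
by rewrite mulrC; exact: (newton_weak x A j.+1).
Qed.

(** The quotients decrease with the order, and [sigma_{m+1}] is the product of the
first [m + 1] of them. *)
Lemma quot_expn_le x A m : gcone x A m.+1 -> quot x A m ^+ m.+1 <= elsym x A m.+1.
Proof.
elim: m => [|m IH] xA; first by rewrite expr1 /quot elsym_zero divr1.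
have x1 := gcone_leq (leqnSn _) xA; have q0 := quot_gt0 xA.
have -> : elsym x A m.+2 = quot x A m.+1 * elsym x A m.+1.
  by rewrite /quot divfK // gt_eqF // x1.
rewrite exprS ler_pM2l //; apply: le_trans _ (IH x1).
by rewrite lerXn2r ?nnegrE ?(ltW (quot_gt0 _)) // quot_mono.
Qed.

Lemma elsym_const1 A j : j.+1%:R * elsym (fun _ : T => 1 : R) A j.+1 =
  (#|A|%:R - j%:R) * elsym (fun=> 1) A j.
Proof.
rewrite -elsym_sum mulrBl -elsym_rem_sum; apply: eq_bigr => p _; exact: mul1r.
Qed.

Lemma gcone_const1 A j : (j <= #|A|)%N -> gcone (fun=> 1 : R) A j.
Proof.
elim: j => [|j IH] jA i; first by rewrite leqn0 => /eqP->; rewrite elsym_zero.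
rewrite leq_eqVlt => /orP[/eqP->|]; last exact: IH (ltnW jA) i.
rewrite -(pmulr_rgt0 _ (ltr0Sn R j)) elsym_const1.
by rewrite mulr_gt0 ?(IH (ltnW jA)) // subr_gt0 ltr_nat.
Qed.

Lemma quot_const1 A j : (j <= #|A|)%N ->
  quot (fun=> 1 : R) A j = (#|A|%:R - j%:R) / j.+1%:R.
Proof.
move=> jA; have e0 := gcone_const1 jA (leqnn j).
rewrite /quot; apply/eqP; rewrite eqr_div ?pnatr_eq0 ?(gt_eqF e0) //.
by rewrite mulrC elsym_const1.
Qed.

Lemma elsym_compl x A j :
  elsym (fun p => x p + (1 - x p)) A j = elsym (fun=> 1) A j.
Proof. by apply: eq_elsym => p _; rewrite addrC subrK. Qed.

Lemma gcone_compl x A j : (j <= #|A|)%N -> gcone (fun p => x p + (1 - x p)) A j.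
Proof. by move=> jA i ij; rewrite elsym_compl; apply: gcone_const1 ij. Qed.

End Bounds.

(** * Consequences of Newton's inequalities near the boundary of the cone *)

Section Degenerate.
Variables (R : realFieldType) (T : finType).
Implicit Types (x u : T -> R) (A : {set T}) (j k m : nat) (s t : R).

(** If the first of four consecutive elementary symmetric polynomials is huge while
the next two are bounded, then the fourth one is small.  Otherwise a small
additional variable of the sign of the fourth one would violate
[newton_augmented]. *)
Lemma elsym_gap_small (K e : R) : 0 < K -> 0 < e -> exists2 L : R, 0 < L &
  forall x A j s, 0 < s -> L * s <= pelsym x A j ->
  `|elsym x A j| <= K * s -> `|elsym x A j.+1| <= K * s ->
  `|elsym x A j.+2| <= e * s.
Proof.
move=> K0 e0; pose t := e / (2 * K); have t0 : 0 < t by rewrite divr_gt0 ?mulr_gt0.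
have tK : t * K = e / 2 by rewrite /t; field; rewrite gt_eqF.
pose M := 2 * ((1 + t) * K) ^+ 2 / e + 1.
have M0 : 0 < M by rewrite ltr_wpDl //; have := ltW e0 => ?; pos.
have eM : ((1 + t) * K) ^+ 2 < e / 2 * M.
  have -> : e / 2 * M = ((1 + t) * K) ^+ 2 + e / 2.
    by rewrite /M; field; rewrite gt_eqF.
  by rewrite ltrDl divr_gt0.
(* With this bound the second polynomial plus [t] times the first is at least [M s]. *)
clearbody M; clearbody t; exists ((M + K) / t).
  by rewrite divr_gt0 ?addr_gt0.
move=> x A j s s0 h1; rewrite !ler_norml => /andP[b1 b2] /andP[c1 c2].
have {}h1 : (M + K) * s <= t * pelsym x A j.
  by move: h1; rewrite mulrAC ler_pdivrMr // [_ * t]mulrC.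
have N1 := newton_augmented x A t j; have N2 := newton_augmented x A (- t) j.
move: (pelsym x A j) (elsym x A j) (elsym x A j.+1) (elsym x A j.+2) h1 b1 b2 c1 c2 N1 N2.
move=> a b c d h1 b1 b2 c1 c2 N1 N2.
have tb : t * b <= t * (K * s) by rewrite ler_pM2l.
have tb' : t * (- (K * s)) <= t * b by rewrite ler_pM2l // mulNr in b1 *.
have tc : t * c <= t * (K * s) by rewrite ler_pM2l.
have tc' : t * (- (K * s)) <= t * c by rewrite ler_pM2l.
have tKs : t * (K * s) = e / 2 * s by rewrite mulrA tK.
have sq (z : R) : - ((1 + t) * K * s) <= z -> z <= (1 + t) * K * s ->
    z ^+ 2 < e / 2 * s * (M * s).
  move=> z1 z2; apply: le_lt_trans (_ : ((1 + t) * K * s) ^+ 2 < _).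
    by rewrite -real_normK ?num_real // lerXn2r ?nnegrE // ?ler_norml ?z1 //
      ltW // !mulr_gt0 // addr_gt0.
  have -> : e / 2 * s * (M * s) = e / 2 * M * s ^+ 2 by ring.
  by rewrite exprMn ltr_pM2r ?exprn_gt0.
have P0 : 0 < e / 2 * s by rewrite mulr_gt0 ?divr_gt0.
have Q0 : 0 < M * s by rewrite mulr_gt0.
have Ks0 : 0 < K * s by rewrite mulr_gt0.
apply/andP; split; rewrite leNgt; apply/negP => H.
  have X : e / 2 * s * (M * s) <= (b + - t * a) * (d + - t * c).
    rewrite -[leRHS]mulrNN [leRHS]mulrC; apply: ler_pM; lra.
  have := lt_le_trans (sq (c + - t * b) _ _) (le_trans X N2).
  by rewrite ltxx => H'; suff: false by []; apply: H'; lra.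
have X : e / 2 * s * (M * s) <= (b + t * a) * (d + t * c).
  rewrite [leRHS]mulrC; apply: ler_pM; lra.
have := lt_le_trans (sq (c + t * b) _ _) (le_trans X N1).
by rewrite ltxx => H'; suff: false by []; apply: H'; lra.
Qed.

(** Removing [x_p] leaves a small quotient of order [m].  For [x_p >= 0] the quotient
decreases, by Newton's inequality.  For [x_p < 0] Newton's inequality of the next
order, together with the lower bound on [sigma_{m+2}], bounds it by a quantity
of order [L^{-1/2}]. *)
Lemma elsym_rem_small m (e : R) : 0 < e -> exists2 L : R, 0 < L &
  forall x A p, p \in A -> gcone x A m.+1 ->
  - elsym x A m.+1 <= elsym x A m.+2 -> L * elsym x A m.+1 <= elsym x A m ->
  elsym x (A :\ p) m.+1 <= e * elsym x (A :\ p) m.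
Proof.
move=> e0; have k0 : 0 < m.+2%:R :> R by rewrite ltr0Sn.
have k1 : 1 <= m.+2%:R :> R by rewrite ler1n.
(* For [c > e b] the estimate [c^2 L <= (m + 2) (b + c) b] fails with this [L]. *)
exists (m.+2%:R * (1 + e) / e ^+ 2).
  by rewrite divr_gt0 ?exprn_gt0 // mulr_gt0 // addr_gt0.
move=> x A p pA xA; have b0 := gcone_rem pA xA (leqnn m).
have s0 := xA m.+1 (leqnn _).
have pe0 := gcone_pelsym (gcone_rem pA xA) (leqnSn m).
have N0 := newton_weak x (A :\ p) m; have N1 := newton x (A :\ p) m.+1.
have kE : m.+2%:R = m.+1%:R + 1 :> R by rewrite natr1.
move: N1 s0; rewrite kE in k0 k1 *; rewrite !(elsym_rem _ _ pA) /=.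
move: (m.+1%:R : R) (ler0n R m.+1) k0 k1 (elsym x (A :\ p) m)
  (elsym x (A :\ p) m.+1) (elsym x (A :\ p) m.+2) (pelsym x (A :\ p) m) (x p) b0 pe0 N0.
move=> k kk k0 k1 b c d a y b0 a0 N0 N1 s0 H1.
set s := c + y * b in s0 H1 *.
rewrite mulrAC ler_pdivrMr ?exprn_gt0 // => H2; rewrite leNgt; apply/negP => cb.
have eb0 : 0 < e * b by rewrite mulr_gt0.
have c0 : 0 < c by apply: lt_trans cb.
have [y0|y0] := lerP 0 y.
  have X : c * (b + y * a) <= s * b.
    rewrite /s; have : y * (a * c) <= y * b ^+ 2 by rewrite ler_wpM2l.
    by lra.
  have X1 : c * ((k + 1) * (1 + e) * s) <= s * b * e ^+ 2.
    apply: le_trans (_ : c * ((b + y * a) * e ^+ 2) <= _).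
      by rewrite ler_pM2l.
    by rewrite mulrA ler_pM2r ?exprn_gt0.
  have X2 : c * ((k + 1) * (1 + e)) <= b * e ^+ 2.
    by rewrite -(ler_pM2l s0); apply: le_trans (le_trans X1 _); lra.
  have X3 : c * e <= c * ((k + 1) * (1 + e)).
    rewrite ler_pM2l //; apply: le_trans (_ : 1 * (1 + e) <= _); first lra.
    by rewrite ler_pM2r; lra.
  by have : c * e <= e * b * e by [lra]; rewrite ler_pM2r // leNgt cb.
have ya : y * a <= 0 by rewrite mulr_le0_ge0 // ltW.
have H3 : (k + 1) * (1 + e) * s <= b * e ^+ 2.
  by apply: le_trans H2 _; rewrite ler_wpM2r ?sqr_ge0 //; lra.
have H4 : c ^+ 2 <= (k + 1) * (b + c) * s.
  have : b * (- s - y * c) <= b * d by rewrite ler_pM2l //; lra.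
  rewrite -(ler_pM2l k0) => /le_trans /(_ N1).
  have -> : b * (- s - y * c) = c ^+ 2 - s * (b + c) by rewrite /s; ring.
  by lra.
have H5 : c ^+ 2 * (1 + e) <= (b + c) * (b * e ^+ 2).
  apply: le_trans (_ : (k + 1) * (b + c) * s * (1 + e) <= _).
    by rewrite ler_pM2r //; lra.
  have -> : (k + 1) * (b + c) * s * (1 + e) = (b + c) * ((k + 1) * (1 + e) * s).
    by ring.
  by rewrite ler_pM2l // addr_gt0.
have : (b + c) * (b * e ^+ 2) < c ^+ 2 * (1 + e).
  have -> : (b + c) * (b * e ^+ 2) = (e * b) ^+ 2 + e * (c * (e * b)) by ring.
  have X1 : (e * b) ^+ 2 < c ^+ 2 by rewrite ltrXn2r ?nnegrE // ltW.
  have X2 : e * (c * (e * b)) < e * (c * c) by rewrite !ltr_pM2l.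
  by lra.
by rewrite ltNge H5.
Qed.

(** Here [b], [c], [d] are the polynomials of degrees [m], [m + 1], [m + 2] without
the variable [y], and [s], [q] those of degrees [m + 1], [m + 2] with it. *)
Lemma elsym_rem2_arith (k C s q b c d y : R) : 0 <= k -> C = 2 * k + 4 ->
  0 < s -> 0 < b -> s = c + y * b -> q = d + y * c -> c <= b -> y <= 1 ->
  - s <= q -> q <= s -> (k + 2) * (b * d) <= (k + 1) * c ^+ 2 ->
  - (C * s) <= d <= C * s.
Proof.
move=> k0 -> s0 b0 sE qE cb y1 q1 q2 N.
have d_ge : y * c <= s.
  have [y0|y0] := lerP 0 y.
    have [c0|c0] := lerP 0 c; last first.
      by apply: le_trans (ltW s0); rewrite mulr_ge0_le0 // ltW.
    have : y * c <= 1 * c by rewrite ler_wpM2r.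
    have : 0 <= y * b by rewrite mulr_ge0 // ltW.
    by lra.
  apply: le_trans (ltW s0); rewrite mulr_le0_ge0 //; first exact: ltW.
  have : y * b <= 0 by rewrite mulr_le0_ge0 // ltW.
  by lra.
have Q : b * (- (y * c)) <= b * ((2 * k + 3) * s).
  have h1 : s * c <= s * b by rewrite ler_pM2l.
  have h2 : b * - q <= b * s by rewrite ler_pM2l //; lra.
  have h3 : (k + 1) * (s * c) <= (k + 1) * (s * b) by rewrite ler_wpM2l //; lra.
  have h4 : (k + 2) * (b * - q) <= (k + 2) * (b * s) by rewrite ler_wpM2l //; lra.
  have E : (k + 1) * c ^+ 2 - (k + 2) * (b * d) =
     (k + 1) * (s * c) + (k + 2) * (b * - q) - b * (- (y * c)).
    by rewrite sE qE; ring.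
  by lra.
rewrite ler_pM2l // in Q.
have ks : 0 <= k * s by rewrite mulr_ge0 // ltW.
by apply/andP; split; lra.
Qed.

(** If [sigma_m] without [x_p] is much larger than [sigma_{m+1}], it suffices to bound
[sigma_{m+2}] without [x_p] by a multiple of [sigma_{m+1}], as in
[elsym_rem2_arith].
Otherwise the large size of [sigma_m] comes from the term with [x_p], so
[sigma_{m-1}] without [x_p] is huge and [elsym_gap_small] applies. *)
Lemma elsym_rem2_small m (e : R) : 0 < e -> exists2 L : R, 0 < L &
  forall x A p, p \in A -> gcone x A m.+1 -> x p <= 1 ->
  `|elsym x A m.+2| <= elsym x A m.+1 -> L * elsym x A m.+1 <= elsym x A m ->
  elsym x (A :\ p) m.+2 ^+ 2 <= e * elsym x A m.+1 * elsym x (A :\ p) m.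
Proof.
move=> e0; have k0 : 0 <= m%:R :> R by rewrite ler0n.
(* [C] is the constant of [elsym_rem2_arith]; [V] separates the two cases. *)
pose C : R := 2 * m%:R + 4; pose V : R := C ^+ 2 / e.
have C0 : 0 < C by rewrite /C; lra.
have V0 : 0 < V by rewrite divr_gt0 ?exprn_gt0.
have e'0 : 0 < e / (1 + e) by rewrite divr_gt0 // addr_gt0.
have [L1 L10 H1] := @elsym_rem_small m 1 ltr01.
have V10 : 0 < 1 + V by rewrite addr_gt0.
have [L2 L20 H2] := elsym_gap_small V10 e'0.
exists (L1 + (L2 + V)); first by rewrite !addr_gt0.
move=> x A p pA xA x1; rewrite ler_norml => /andP[q1 q2] HL.
have s0 := xA m.+1 (leqnn _).
have cb : elsym x (A :\ p) m.+1 <= 1 * elsym x (A :\ p) m.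
  apply: H1 => //; apply: le_trans HL; rewrite ler_pM2r //; lra.
have b0 := gcone_rem pA xA (leqnn m).
have a0 := gcone_pelsym (gcone_rem pA xA) (leqnSn m).
have N1 := newton x (A :\ p) m.+1.
have sE := elsym_rem x m.+1 pA; have eE := elsym_rem x m.+2 pA.
have fE := elsym_rem x m pA.
have {}H2 := H2 x (A :\ p) m (elsym x A m.+1) s0.
have kE1 : m.+2%:R = m%:R + 2 :> R by rewrite -addn2 natrD.
have kE2 : m.+1%:R = m%:R + 1 :> R by rewrite natr1.
rewrite /= kE1 kE2 in N1; rewrite mul1r in cb.
have /andP[d1 d2] := elsym_rem2_arith k0 (erefl C) s0 b0 sE eE cb x1 q1 q2 N1.
move: H2 sE fE HL d1 d2 s0 b0 a0 cb; clear H1 eE N1 q1 q2 => /=.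
move: (elsym x A m) (elsym x A m.+1) (elsym x (A :\ p) m) (elsym x (A :\ p) m.+1)
  (elsym x (A :\ p) m.+2) (pelsym x (A :\ p) m) (x p) x1.
move=> f s b c d a y y1 H2 sE fE HL d1 d2 s0 b0 a0 cb.
have [bV|bV] := lerP (V * s) b.
  apply: le_trans (_ : (C * s) ^+ 2 <= _).
    rewrite -real_normK ?num_real // lerXn2r ?nnegrE ?ler_norml ?d1 //.
    by rewrite mulr_ge0 // ltW.
  have -> : (C * s) ^+ 2 = e * s * (V * s) by rewrite /V; field; rewrite gt_eqF.
  by rewrite ler_pM2l // mulr_gt0.
have ya : (L1 + L2) * s <= y * a by lra.
have L12 : 0 < L1 + L2 by rewrite addr_gt0.
have ya0 : 0 < y * a by apply: lt_le_trans ya; rewrite mulr_gt0.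
have y0 : 0 < y.
  by rewrite ltNge; apply/negP => y0; move: ya0; rewrite ltNge mulr_le0_ge0.
have {H2}d3 : `|d| <= e / (1 + e) * s.
  apply: H2.
  - have : y * a <= 1 * a by rewrite ler_wpM2r.
    by have := mulr_gt0 L10 s0; lra.
  - by rewrite gtr0_norm //; lra.
  - rewrite ler_norml; have yb : y * b <= 1 * b by rewrite ler_wpM2r // ltW.
    by apply/andP; split; lra.
have s2b : s <= 2 * b.
  by have yb : y * b <= 1 * b by [rewrite ler_wpM2r // ltW]; lra.
apply: le_trans (_ : (e / (1 + e) * s) ^+ 2 <= _).
  by rewrite -real_normK ?num_real // lerXn2r ?nnegrE // mulr_ge0 // ltW.
apply: le_trans (_ : e / 2 * s ^+ 2 <= _); last first.
  have -> : e / 2 * s ^+ 2 = e * s * (s / 2) by field.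
  by rewrite ler_pM2l ?mulr_gt0 //; lra.
rewrite exprMn ler_pM2r ?exprn_gt0 // expr_div_n ler_pdivrMr ?exprn_gt0 ?addr_gt0 //.
have -> : e / 2 * (1 + e) ^+ 2 = e ^+ 2 + e / 2 * (1 + e ^+ 2) by field.
by rewrite lerDl; have := sqr_ge0 e; nra.
Qed.
End Degenerate.

(** * The test vector x - x^2 *)

Section TestVector.
Variables (R : realFieldType) (T : finType).
Implicit Types (x u : T -> R) (A : {set T}) (j k m : nat) (s t : R).

(** For [j = k - 1] this is [sigma_{k+1} / sigma_{k-1}], the error term in the
computations with [test_vector]. *)
Definition skip_quot x A j : R := elsym x A j.+2 / elsym x A j.
Definition dskip_quot x A j u : R :=
  (delsym x A j.+2 u - skip_quot x A j * delsym x A j u) / elsym x A j.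

(** The vector [x - x^2], written with a scalar multiple so that linearity
lemmas apply.  If [A] has [j + 1] elements, it gives equality in [quot_concave]
for [w = 1 - x]; this motivates its use when [sigma_{j+2}] is negligible. *)
Definition test_vector x p : R := x p + -1 * x p ^+ 2.

Lemma dquot_test x A j : elsym x A j != 0 ->
  dquot x A j (test_vector x) =
  quot x A j - (j.+1%:R * quot x A j ^+ 2 - j.+2%:R * skip_quot x A j).
Proof.
move=> s0; rewrite /test_vector dquotD dquotZ /dquot !delsym_id !delsym_sqr /skip_quot /quot.
rewrite -[j.+2%:R]natr1 -[j.+1%:R]natr1.
by field.
Qed.

Lemma dskip_quot_test x A j : elsym x A j != 0 ->
  dskip_quot x A j (test_vector x) = 2 * skip_quot x A j +
  (j.+3%:R * elsym x A j.+3 / elsym x A j - j.+1%:R * quot x A j * skip_quot x A j).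
Proof.
move=> s0; rewrite /test_vector /dskip_quot !delsymD !delsymZ !delsym_id !delsym_sqr /skip_quot /quot.
rewrite -[j.+3%:R]natr1 -[j.+2%:R]natr1 -[j.+1%:R]natr1.
by field.
Qed.

(** The weight [1 - x] cancels against the factor [1 - x_p] of the test vector.
What remains is a multiple of [dquot], up to the derivative of [skip_quot]. *)
Lemma weighted_hess_test x A j u : elsym x A j.+1 != 0 -> (forall p, p \in A -> x p < 1) ->
  weighted_hess x (fun p => 1 - x p) A j.+1 (test_vector x) u =
  2 * (j.+2%:R * quot x A j.+1 * dquot x A j.+1 u) - j.+3%:R * dskip_quot x A j.+1 u.
Proof.
move=> s0 x1.
have E1 : \sum_(p in A) gquot x A j.+1 p * (test_vector x p * u p) / (1 - x p) =
    (\sum_(p in A) x p * u p * elsym x (A :\ p) j.+1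
      - quot x A j.+1 * \sum_(p in A) x p * u p * elsym x (A :\ p) j) / elsym x A j.+1.
  rewrite mulr_sumr -sumrB mulr_suml; apply: eq_bigr => p pA.
  rewrite /test_vector /gquot /=; field; rewrite s0 /= subr_eq0 gt_eqF //; exact: x1.
have E2 i : \sum_(p in A) x p * u p * elsym x (A :\ p) i =
    elsym x A i.+1 * (\sum_(p in A) u p) - delsym x A i.+2 u.
  rewrite /delsym mulr_sumr -sumrB; apply: eq_bigr => p pA.
  by rewrite (elsym_rem x i.+1 pA) /=; ring.
rewrite /weighted_hess E1 /test_vector d2quotD d2quotZ /d2quot !d2elsym_id !d2elsym_sqr !E2.
rewrite /dquot !delsym_id !delsym_sqr /dskip_quot /skip_quot /quot.
rewrite -[j.+3%:R]natr1 -[j.+2%:R]natr1 -[j.+1%:R]natr1.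
by field.
Qed.

End TestVector.

(** * Bounds for the reduced form *)

Lemma sqr_sum_le (R : realFieldType) (I : finType) (A : {set I}) (a D b : I -> R) :
  (forall p, p \in A -> 0 <= D p) -> (forall p, p \in A -> 0 <= b p) ->
  (forall p, p \in A -> a p ^+ 2 <= D p * b p) ->
  (\sum_(p in A) a p) ^+ 2 <= (\sum_(p in A) D p) * (\sum_(p in A) b p).
Proof.
move=> D0 b0 H.
have : [/\ 0 <= \sum_(p in A) D p, 0 <= \sum_(p in A) b p &
  (\sum_(p in A) a p) ^+ 2 <= (\sum_(p in A) D p) * (\sum_(p in A) b p)]; last by case.
apply: (big_ind3 (fun D b a => [/\ 0 <= D, 0 <= b & a ^+ 2 <= D * b])).
- by rewrite expr0n mulr0.
- move=> D1 b1 a1 D2 b2 a2 [? ? ?] [? ? ?]; split; rewrite ?addr_ge0 //.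
  exact: sqr_add_le.
- by move=> p pA; rewrite D0 ?b0 ?H.
Qed.

Section Estimate.
Variables (R : realFieldType) (T : finType).
Implicit Types (x u w : T -> R) (A : {set T}) (j k m : nat) (s t d : R).

(** With [m + 2 = k] and [lambda_1 = 1] this is [F^{pp} / (s (1 - x_p))]. *)
Definition diag_weight x A m p : R :=
  (elsym x (A :\ p) m.+1 + elsym x (A :\ p) m) / (elsym x A m.+1 * (1 - x p)).

(** What remains of the quadratic form once the square in [xi_1] has been
completed; the first term is a fraction of the square of the logarithmic
derivative of [sigma_{k-1}], kept to control error terms. *)
Definition reduced_form x A m d u : R :=
  d * (1 + quot x A m.+1) * (delsym x A m.+1 u / elsym x A m.+1) ^+ 2
  + 2 * (\sum_(p in A) diag_weight x A m p * u p ^+ 2) - d2quot x A m.+1 u u.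

Lemma reduced_form_bound x w A m d u :
  (forall p, p \in A -> 0 < w p) -> gcone x A m.+1 ->
  gcone (fun p => x p + w p) A m.+1 -> 0 <= d -> 0 <= 1 + quot x A m.+1 ->
  (forall p, p \in A -> gquot x A m.+1 p <= diag_weight x A m p * w p) ->
  2 * dquot x A m.+1 u ^+ 2 <=
  (quot (fun p => x p + w p) A m.+1 - quot x A m.+1) * reduced_form x A m d u.
Proof.
move=> w0 xA LA d0 h0 H; have [D0 P0 B] := quot_concave u w0 xA LA.
apply: le_trans B _; rewrite ler_wpM2l ?subr_ge0 // /weighted_hess /reduced_form lerD2r.
apply: ler_wpDl; first by rewrite mulr_ge0 ?sqr_ge0 // mulr_ge0.
rewrite ler_pM2l //; apply: ler_sum => p pA.
rewrite -expr2 mulrAC ler_wpM2r ?sqr_ge0 // ler_pdivrMr ?w0 //; exact: H.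
Qed.

(** The shift [w = 1 - x] leads to the vector of ones. *)
Lemma reduced_form_bound_far x A m d u : (m.+1 <= #|A|)%N ->
  (forall p, p \in A -> x p < 1) -> gcone x A m.+1 -> 0 <= d ->
  0 <= 1 + quot x A m.+1 ->
  2 * dquot x A m.+1 u ^+ 2 <=
  ((#|A|%:R - m.+1%:R) / m.+2%:R - quot x A m.+1) * reduced_form x A m d u.
Proof.
move=> mA x1 xA d0 h0.
have QL : quot (fun p => x p + (1 - x p)) A m.+1 = (#|A|%:R - m.+1%:R) / m.+2%:R.
  by rewrite -(quot_const1 R mA) /quot !elsym_compl.
rewrite -QL; apply: reduced_form_bound => // [p pA||p pA].
- by rewrite subr_gt0 x1.
- exact: gcone_compl.
have s0 := xA m.+1 (leqnn _); have y0 : 0 < 1 - x p by rewrite subr_gt0 x1.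
have b0 := gcone_rem pA xA (leqnn m).
rewrite /gquot /diag_weight invfM mulrA divfK ?gt_eqF // ler_pM2r ?invr_gt0 //.
rewrite lerD2l -mulNr /=; have := mulr_ge0 h0 (ltW b0); lra.
Qed.

(** A constant shift [e] is admissible since the ratio of [gquot] to [diag_weight] at
[p] is [(1 - x_p) (G - q) / (1 + G)], where [G <= g] is the quotient of order [m]
without [x_p], [q] is [quot x A m.+1], and [1 + G >= 1 + q >= h].  The shift
increases [quot] by little, even if its derivative is large. *)
Lemma reduced_form_bound_shift x A m d u (B e h g y : R) :
  (forall p, p \in A -> x p < 1) -> (forall p, p \in A -> 1 - x p <= B) ->
  gcone x A m.+1 -> 0 <= d -> 0 < e -> 0 < h -> 0 <= g -> 0 <= y ->
  h <= 1 + quot x A m.+1 -> - y <= quot x A m.+1 ->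
  (forall p, p \in A -> elsym x (A :\ p) m.+1 <= g * elsym x (A :\ p) m) ->
  B * (g + y) <= e * h ->
  2 * dquot x A m.+1 u ^+ 2 <= (y + e * #|A|%:R) * reduced_form x A m d u.
Proof.
move=> x1 xB xA d0 e0 hp g0 y0 hq yq Hg HB.
have s0 := xA m.+1 (leqnn _).
have LA := gcone_shift xA (ltW e0).
have h0 : 0 <= 1 + quot x A m.+1 by lra.
have W p : p \in A -> gquot x A m.+1 p <= diag_weight x A m p * e.
  move=> pA; have z0 : 0 < 1 - x p by rewrite subr_gt0 x1.
  have b0 := gcone_rem pA xA (leqnn m).
  have := gquot_ge0 x m.+1 pA; rewrite /gquot /diag_weight /= pmulr_lge0 ?invr_gt0 //.
  move=> N0; set c := elsym _ _ m.+1 in N0 *; set b := elsym _ _ m in b0 N0 *.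
  have -> : (c + b) / (elsym x A m.+1 * (1 - x p)) * e =
      e * (c + b) / (1 - x p) / elsym x A m.+1.
    by field; rewrite (gt_eqF s0) (gt_eqF z0).
  rewrite ler_pM2r ?invr_gt0 // ler_pdivlMr //.
  have zB := xB _ pA; have cg := Hg _ pA.
  move: (quot x A m.+1) h0 hq yq N0 => q h0 hq yq N0.
  rewrite -/c -/b in cg; clearbody b c.
  apply: le_trans (_ : (c - q * b) * B <= _); first by rewrite ler_wpM2l.
  apply: le_trans (_ : (g + y) * b * B <= _).
    rewrite ler_wpM2r //; first by apply: le_trans zB; exact: ltW.
    have : - y * b <= q * b by rewrite ler_wpM2r // ltW.
    by lra.
  apply: le_trans (_ : e * h * b <= _).
    by have := ler_wpM2r (ltW b0) HB; lra.
  have : h * b <= (1 + q) * b by rewrite ler_wpM2r // ltW.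
  by move=> H; rewrite -mulrA ler_pM2l //; lra.
have P0 : 0 <= reduced_form x A m d u.
  rewrite /reduced_form; have := d2quot_le0 u xA.
  have : 0 <= \sum_(p in A) diag_weight x A m p * u p ^+ 2.
    apply: sumr_ge0 => p pA; rewrite mulr_ge0 ?sqr_ge0 //.
    by have := le_trans (gquot_ge0 x m.+1 pA) (W p pA); rewrite pmulr_lge0.
  have : 0 <= d * (1 + quot x A m.+1) * (delsym x A m.+1 u / elsym x A m.+1) ^+ 2.
    by rewrite mulr_ge0 ?sqr_ge0 // mulr_ge0.
  lra.
apply: le_trans (reduced_form_bound u _ xA LA d0 h0 W) _; first by [].
rewrite ler_wpM2r //.
have [q0|q0] := lerP 0 (quot x A m.+1).
  by have := quot_shift_le xA (ltW e0) q0 (lexx _); lra.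
by have := quot_shift_le xA (ltW e0) (lexx 0) (ltW q0); lra.
Qed.

End Estimate.

Section TestVectorBounds.
Variables (R : realFieldType) (T : finType).
Implicit Types (x u w : T -> R) (A : {set T}) (j k m : nat) (s t d : R).

Lemma young_sqr (a b t : R) : 0 < t ->
  a ^+ 2 <= (1 + t) * (a - b) ^+ 2 + (1 + t^-1) * b ^+ 2.
Proof.
move=> t0; have : 0 <= (t * (a - b) - b) ^+ 2 / t by rewrite divr_ge0 ?sqr_ge0 // ltW.
rewrite -subr_ge0 => H; rewrite -subr_ge0; apply: le_trans H _.
by rewrite le_eqVlt; apply/orP; left; apply/eqP; field; rewrite gt_eqF.
Qed.

(** The error term [V] is separated from [D] by Young's inequality with a parameter
[t] so small that the main term is hardly enlarged.  In terms of
[E = k^2 y^2 e], the three losses are at most [E] each, and [4 E] is available. *)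
Lemma test_vector_arith (k y e q D V X H P e7 e8 : R) :
  1 <= k -> 0 < y -> 0 < e -> -1 <= q -> q <= - y ->
  let E := k ^+ 2 * y ^+ 2 * e in let t := E / (2 * k + 2 * k ^+ 2) in
  e8 = E / (1 + t) -> e7 = E / ((1 + t^-1) * (k + 1) ^+ 2) ->
  0 <= H -> H <= P -> 0 <= X -> X <= 2 * k * q ^+ 2 - 2 * k ^+ 2 * q ^+ 3 + e8 ->
  V ^+ 2 <= e7 * P ->
  (2 * (k * q * D) - (k + 1) * V) ^+ 2 <= X * H ->
  D ^+ 2 <= ((k^-1 - q) / 2 + e) * P.
Proof.
move=> k1 y0 e0 q1 qy E t e8E e7E H0 HP X0 XM VP CS.
have k0 : 0 < k by lra.
have E0 : 0 < E by rewrite !mulr_gt0 ?exprn_gt0.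
have B0 : 0 < 2 * k + 2 * k ^+ 2 by rewrite addr_gt0 ?mulr_gt0 ?exprn_gt0.
have t0 : 0 < t by rewrite divr_gt0.
have t1 : 0 < 1 + t by lra.
have t2 : 0 < 1 + t^-1 by have : 0 < t^-1 by [rewrite invr_gt0]; lra.
have P0 : 0 <= P by lra.
have q0 : q < 0 by lra.
set M := 2 * k * q ^+ 2 - 2 * k ^+ 2 * q ^+ 3 in XM.
have MB : M <= 2 * k + 2 * k ^+ 2.
  have q2 : q ^+ 2 <= 1 by nra.
  have q3 : - q ^+ 3 <= 1 by have -> : q ^+ 3 = q * q ^+ 2 by [ring]; nra.
  have kk : 0 <= k ^+ 2 by exact: sqr_ge0.
  have a1 : k * q ^+ 2 <= k * 1 by rewrite ler_pM2l.
  have a2 : k ^+ 2 * - q ^+ 3 <= k ^+ 2 * 1 by rewrite ler_wpM2l.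
  by rewrite /M; lra.
have S1 : (2 * (k * q * D)) ^+ 2 <=
    ((1 + t) * X + (1 + t^-1) * (k + 1) ^+ 2 * e7) * P.
  apply: le_trans (young_sqr _ ((k + 1) * V) t0) _; rewrite [leRHS]mulrDl lerD //.
    rewrite -[leRHS]mulrA ler_pM2l //; apply: le_trans CS _; exact: ler_wpM2l.
  by rewrite exprMn -!(mulrA (1 + t^-1)) ler_pM2l // -mulrA ler_wpM2l ?sqr_ge0.
have S2 : (1 + t) * X + (1 + t^-1) * (k + 1) ^+ 2 * e7 <= M + 3 * E.
  have -> : (1 + t^-1) * (k + 1) ^+ 2 * e7 = E.
    rewrite e7E mulrC divfK // mulf_neq0 ?gt_eqF // exprn_gt0 //; lra.
  have : (1 + t) * X <= (1 + t) * (M + e8) by rewrite ler_pM2l.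
  have -> : (1 + t) * (M + e8) = M + t * M + E.
    by rewrite e8E; field; rewrite gt_eqF.
  have : t * M <= E by rewrite -[leRHS](divfK (lt0r_neq0 B0)) ler_pM2l.
  lra.
have S3 : (2 * (k * q * D)) ^+ 2 <= (M + 4 * (k ^+ 2 * q ^+ 2 * e)) * P.
  apply: le_trans S1 _; rewrite ler_wpM2r //; apply: le_trans S2 _.
  rewrite lerD2l; have : E <= k ^+ 2 * q ^+ 2 * e.
    rewrite /E ler_pM2r // ler_pM2l ?exprn_gt0 // -(sqrrN q).
    by rewrite lerXn2r ?nnegrE; lra.
  lra.
have c0 : 0 < 4 * (k ^+ 2 * q ^+ 2).
  have qq : 0 < q ^+ 2 by rewrite -sqrrN exprn_gt0 //; lra.
  have kk : 0 < k ^+ 2 by rewrite exprn_gt0.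
  by rewrite mulr_gt0 // mulr_gt0.
rewrite -(ler_pM2l c0); move: S3.
have -> : (2 * (k * q * D)) ^+ 2 = 4 * (k ^+ 2 * q ^+ 2) * D ^+ 2 by ring.
move=> /le_trans; apply; rewrite [leRHS]mulrA ler_wpM2r // le_eqVlt; apply/orP; left.
by apply/eqP; rewrite /M; field; rewrite gt_eqF.
Qed.

(** Since [F^{pp} / s] is [gquot] plus [h] times the logarithmic partial derivative of
[s], the weighted Hessian for [w = 1 - x] comes with two additional nonnegative
terms.  They control the derivative of [skip_quot] in [dskip_quot_bound]. *)
Lemma reduced_form_weighted_hess x A m d u : gcone x A m.+1 -> (forall p, p \in A -> x p < 1) ->
  reduced_form x A m d u =
  d * (1 + quot x A m.+1) * (delsym x A m.+1 u / elsym x A m.+1) ^+ 2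
  + 2 * (1 + quot x A m.+1) * (\sum_(p in A)
      elsym x (A :\ p) m * u p ^+ 2 / (elsym x A m.+1 * (1 - x p)))
  + weighted_hess x (fun p => 1 - x p) A m.+1 u u.
Proof.
move=> xA x1; rewrite /reduced_form /weighted_hess [RHS]addrA; congr (_ - _).
rewrite -[RHS]addrA; congr (_ + _).
rewrite -mulrA -mulrDr; congr (_ * _); rewrite mulr_sumr -big_split /=.
apply: eq_bigr => p pA; have s0 := xA m.+1 (leqnn _).
have z0 : 0 < 1 - x p by rewrite subr_gt0 x1.
by rewrite /diag_weight /gquot /=; field; rewrite (gt_eqF s0) (gt_eqF z0).
Qed.

Lemma dskip_quot_bound x A m u (B e f : R) : gcone x A m.+1 ->
  (forall p, p \in A -> x p < 1) -> (forall p, p \in A -> 1 - x p <= B) ->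
  0 <= e -> `|elsym x A m.+3| <= f * elsym x A m.+1 ->
  (forall p, p \in A ->
    elsym x (A :\ p) m.+2 ^+ 2 <= e * elsym x A m.+1 * elsym x (A :\ p) m) ->
  dskip_quot x A m.+1 u ^+ 2 <=
  2 * (#|A|%:R * (e * B)) * (\sum_(p in A)
      elsym x (A :\ p) m * u p ^+ 2 / (elsym x A m.+1 * (1 - x p)))
  + 2 * f ^+ 2 * (delsym x A m.+1 u / elsym x A m.+1) ^+ 2.
Proof.
move=> xA x1 xB e0 wf H; have s0 := xA m.+1 (leqnn _).
have E1 : dskip_quot x A m.+1 u =
   \sum_(p in A) u p * elsym x (A :\ p) m.+2 / elsym x A m.+1
   - elsym x A m.+3 / elsym x A m.+1 * (delsym x A m.+1 u / elsym x A m.+1).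
  rewrite /dskip_quot /skip_quot -mulr_suml -/(delsym x A m.+3 u); field.
  by rewrite gt_eqF.
have S1 : (\sum_(p in A) u p * elsym x (A :\ p) m.+2 / elsym x A m.+1) ^+ 2 <=
   (#|A|%:R * (e * B)) * (\sum_(p in A)
      elsym x (A :\ p) m * u p ^+ 2 / (elsym x A m.+1 * (1 - x p))).
  have -> : #|A|%:R * (e * B) = \sum_(p in A) e * B by rewrite sumr_const mulr_natl.
  apply: sqr_sum_le => p pA; have z0 : 0 < 1 - x p by rewrite subr_gt0 x1.
  - by rewrite mulr_ge0 //; apply: le_trans (xB p pA); exact: ltW.
  - have b0 := gcone_rem pA xA (leqnn m).
    by have := ltW b0; have := ltW s0; have := ltW z0 => ? ? ?; pos.
  have b0 := gcone_rem pA xA (leqnn m).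
  apply: le_trans (_ : u p ^+ 2 * (e * elsym x (A :\ p) m) / elsym x A m.+1 <= _).
    have -> : (u p * elsym x (A :\ p) m.+2 / elsym x A m.+1) ^+ 2 =
      u p ^+ 2 * (elsym x (A :\ p) m.+2 ^+ 2 / elsym x A m.+1) / elsym x A m.+1.
      by field; rewrite gt_eqF.
    rewrite ler_pM2r ?invr_gt0 // ler_wpM2l ?sqr_ge0 // ler_pdivrMr //.
    by rewrite mulrAC; exact: H.
  have -> : e * B * (elsym x (A :\ p) m * u p ^+ 2 / (elsym x A m.+1 * (1 - x p))) =
    u p ^+ 2 * (e * elsym x (A :\ p) m) / elsym x A m.+1 * (B / (1 - x p)).
    by field; rewrite (gt_eqF s0) (gt_eqF z0).
  rewrite ler_peMr //; last by rewrite ler_pdivlMr // mul1r xB.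
  by have := ltW b0; have := ltW s0; have := ltW z0 => ? ? ?; pos.
have S2 : (elsym x A m.+3 / elsym x A m.+1 * (delsym x A m.+1 u / elsym x A m.+1)) ^+ 2
   <= f ^+ 2 * (delsym x A m.+1 u / elsym x A m.+1) ^+ 2.
  rewrite exprMn ler_wpM2r ?sqr_ge0 // -real_normK ?num_real // lerXn2r ?nnegrE //.
    have := le_trans (normr_ge0 _) wf; by rewrite pmulr_lge0.
  by rewrite normrM normfV [X in _ / X]gtr0_norm // ler_pdivrMr.
rewrite E1; move: S1 S2.
set a := \sum_(p in A) _; set b := _ / _ * _.
by have := sqr_ge0 (a + b); lra.
Qed.

End TestVectorBounds.

Section DegenerateRegime.
Variables (R : realFieldType) (T : finType).
Implicit Types (x u w : T -> R) (A : {set T}) (j k m : nat) (s t d : R).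

(** The value of the form at [test_vector], with [w] and [v] for the ratios
[sigma_{k+1} / sigma_{k-1}] and [sigma_{k+2} / sigma_{k-1}]. *)
Lemma weighted_hess_test_le (k q w v y f : R) : 1 <= k -> 0 < y -> -1 <= q -> q <= - y ->
  0 <= f -> f <= 1 -> `|w| <= f -> - (f / y) <= v ->
  2 * (k * q * (q - (k * q ^+ 2 - (k + 1) * w))) -
    (k + 1) * (2 * w + ((k + 2) * v - k * q * w))
  <= 2 * k * q ^+ 2 - 2 * k ^+ 2 * q ^+ 3 +
     (5 * k * (k + 1) + (k + 1) * (k + 2) / y) * f.
Proof.
move=> k1 y0 q1 qy f0 f1; rewrite ler_norml => /andP[w1 w2] v1.
have kw : (k + 1) * (k + 2) * - v <= (k + 1) * (k + 2) / y * f.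
  have -> : (k + 1) * (k + 2) / y * f = (k + 1) * (k + 2) * (f / y) by ring.
  by rewrite ler_wpM2l //; nra.
have kk : 0 <= k * (k + 1) by nra.
have e1 : (3 * (k * (k + 1)) * q - 2 * (k + 1)) * w <= 5 * k * (k + 1) * f.
  have a1 : 0 <= 5 * k * (k + 1) - (3 * (k * (k + 1)) * q - 2 * (k + 1)) by nra.
  have a2 : 0 <= 5 * k * (k + 1) + (3 * (k * (k + 1)) * q - 2 * (k + 1)) by nra.
  by nra.
by lra.
Qed.

(** Newton's inequality bounds [v / s] from below as [q] is negative and bounded away
from 0. *)
Lemma newton_ratio_ge (s q y f w v : R) : 0 < s -> 0 < y -> 0 <= f -> f <= 1 ->
  q <= - y -> `|w| <= f * s -> q * s * v <= w ^+ 2 -> - (f / y) <= v / s.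
Proof.
move=> s0 y0 f0 f1 qy wf N.
have W : w ^+ 2 <= f * s ^+ 2.
  apply: le_trans (_ : (f * s) ^+ 2 <= _).
    by rewrite -real_normK ?num_real // lerXn2r ?nnegrE // mulr_ge0 // ltW.
  by rewrite exprMn ler_wpM2r ?sqr_ge0 // expr2 ler_piMl.
have {N W}qv : q * v <= f * s.
  by rewrite -(ler_pM2r s0); have := le_trans N W; lra.
rewrite ler_pdivlMr // (_ : - (f / y) * s = - (f * s / y)); last by ring.
rewrite lerNl ler_pdivlMr //.
have [v0|v0] := lerP 0 v.
  apply: le_trans (_ : 0 <= _); last by rewrite mulr_ge0 // ltW.
  by rewrite mulNr oppr_le0 mulr_ge0 // ltW.
apply: le_trans qv; have -> : q * v = - v * - q by rewrite mulrNN mulrC.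
by rewrite ler_pM2l ?oppr_gt0 //; lra.
Qed.

(** Cauchy-Schwarz with [test_vector].  All constants are chosen before [x]: the
error terms fall below them once [sigma_m / sigma_{m+1}] exceeds [L]. *)
Lemma reduced_form_bound_degenerate A m (B h y d e : R) :
  (m.+1 <= #|A|)%N -> 0 < B -> 0 < h -> 0 < y -> 0 < d -> 0 < e ->
  exists2 L : R, 0 < L & forall x u,
  (forall p, p \in A -> x p < 1) -> (forall p, p \in A -> 1 - x p <= B) ->
  gcone x A m.+1 -> h <= 1 + quot x A m.+1 -> quot x A m.+1 <= - y ->
  L * elsym x A m.+1 <= elsym x A m ->
  dquot x A m.+1 u ^+ 2 <=
  ((m.+2%:R^-1 - quot x A m.+1) / 2 + e) * reduced_form x A m d u.
Proof.
move=> mA B0 h0 y0 d0 e0; pose k : R := m.+2%:R.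
have k1 : 1 <= k by rewrite ler1n.
have k0 : 0 < k by lra.
(* [E], [t], [e8] and [e7] are those of [test_vector_arith]; [f] will bound the
   ratio of degrees [m + 3] and [m + 1], and [g] the error of [elsym_rem2_small]. *)
pose E := k ^+ 2 * y ^+ 2 * e; pose t := E / (2 * k + 2 * k ^+ 2).
have E0 : 0 < E by rewrite !mulr_gt0 ?exprn_gt0.
have t0 : 0 < t by rewrite divr_gt0 // addr_gt0 ?mulr_gt0 ?exprn_gt0.
have ti0 : 0 < t^-1 by rewrite invr_gt0.
pose e8 := E / (1 + t); pose e7 := E / ((1 + t^-1) * (k + 1) ^+ 2).
have e80 : 0 < e8 by rewrite divr_gt0 // addr_gt0.
have e70 : 0 < e7 by rewrite divr_gt0 ?mulr_gt0 ?exprn_gt0 ?addr_gt0.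
have e8E : e8 = E / (1 + t) by [].
have e7E : e7 = E / ((1 + t^-1) * (k + 1) ^+ 2) by [].
clearbody e8 e7.
pose C2 := 5 * k * (k + 1) + (k + 1) * (k + 2) / y.
have C20 : 0 < C2 by rewrite addr_gt0 ?divr_gt0 ?mulr_gt0 ?addr_gt0.
pose f := Num.min 1 (Num.min (e8 / C2) (e7 * d * h / 4)).
have f0 : 0 < f.
  have a1 : 0 < e8 / C2 by rewrite divr_gt0.
  have a2 : 0 < e7 * d * h / 4 by rewrite divr_gt0 ?mulr_gt0.
  by rewrite !lt_min ltr01 a1 a2.
have f1 : f <= 1 by rewrite ge_min lexx.
have f2 : C2 * f <= e8.
  by rewrite mulrC -ler_pdivlMr // !ge_min lexx orbT.
have f3 : 2 * f ^+ 2 <= e7 / 2 * (d * h).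
  have f4 : f <= e7 * d * h / 4 by rewrite !ge_min lexx !orbT.
  have : f ^+ 2 <= f * 1 by rewrite expr2 ler_pM2l.
  by lra.
pose g := e7 * h / (2 * (#|A|%:R * B + 1)).
have NB0 : 0 <= #|A|%:R * B by rewrite mulr_ge0 // ltW.
have g0 : 0 < g by rewrite divr_gt0 ?mulr_gt0 // ltr_wpDl.
have g1 : 2 * (#|A|%:R * (g * B)) <= e7 / 2 * (2 * h).
  have -> : 2 * (#|A|%:R * (g * B)) = #|A|%:R * B / (#|A|%:R * B + 1) * (e7 * h).
    by rewrite /g; field; rewrite gt_eqF // ltr_wpDl.
  have -> : e7 / 2 * (2 * h) = 1 * (e7 * h) by field.
  rewrite ler_pM2r ?mulr_gt0 // ler_pdivrMr ?ltr_wpDl //; lra.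
have [L1 L10 H1] := elsym_gap_small T (ltr01 : 0 < 1 :> R) f0.
have [L2 L20 H2] := elsym_rem2_small T m g0.
exists (L1 + L2); first exact: addr_gt0.
move=> x u x1 xB xA hq qy HL; have s0 := xA m.+1 (leqnn _).
have eE : elsym x A m.+2 = quot x A m.+1 * elsym x A m.+1.
  by rewrite /quot divfK // gt_eqF.
have q1 : -1 <= quot x A m.+1 by lra.
have n1 : `|elsym x A m.+2| <= elsym x A m.+1.
  rewrite eE normrM [X in _ * X]gtr0_norm // ger_pMl // ler_norml; lra.
have HL1 : L1 * elsym x A m.+1 <= elsym x A m.
  by have := mulr_gt0 L20 s0; lra.
have HL2 : L2 * elsym x A m.+1 <= elsym x A m.
  by have := mulr_gt0 L10 s0; lra.
have W3 : `|elsym x A m.+3| <= f * elsym x A m.+1.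
  by apply: (H1 x A m.+1) => //; rewrite ?mul1r // gtr0_norm.
have rem p : p \in A ->
    elsym x (A :\ p) m.+2 ^+ 2 <= g * elsym x A m.+1 * elsym x (A :\ p) m.
  by move=> pA; apply: H2 => //; exact: ltW (x1 p pA).
have DW := dskip_quot_bound u xA x1 xB (ltW g0) W3 rem.
have PE := reduced_form_weighted_hess d u xA x1.
have LA := gcone_compl x mA.
have w0 p : p \in A -> 0 < 1 - x p by move=> pA; rewrite subr_gt0 x1.
have [_ H0 _] := quot_concave u w0 xA LA.
pose X := test_vector x.
have [_ X0 _] := quot_concave X w0 xA LA.
have CS := weighted_hess_cauchy_schwarz X u w0 xA LA.
have sn0 : elsym x A m.+1 != 0 by rewrite gt_eqF.
rewrite (weighted_hess_test u sn0 x1) in CS.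
set S := \sum_(p in A) _ in DW PE.
have S0 : 0 <= S.
  apply: sumr_ge0 => p pA; have := ltW (gcone_rem pA xA (leqnn m)).
  by have := ltW s0; have := ltW (w0 p pA) => ? ? ?; pos.
set G := (delsym x A m.+1 u / elsym x A m.+1) ^+ 2 in DW PE.
have G0 : 0 <= G by exact: sqr_ge0.
clearbody S G.
have hG : d * h * G <= d * (1 + quot x A m.+1) * G.
  by rewrite ler_wpM2r // ler_pM2l.
have hS : 2 * h * S <= 2 * (1 + quot x A m.+1) * S.
  by rewrite ler_wpM2r // ler_pM2l.
have hG0 : 0 <= d * h * G by rewrite !mulr_ge0 // ltW.
have hS0 : 0 <= 2 * h * S by rewrite !mulr_ge0 // ltW.
have kE3 : m.+3%:R = k + 1 by rewrite natr1.
have kE4 : m.+4%:R = k + 2 by rewrite /k -[m.+4]addn2 natrD.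
apply: (@test_vector_arith R k y e (quot x A m.+1) _ (dskip_quot x A m.+1 u)
  (weighted_hess x (fun p => 1 - x p) A m.+1 X X)
  (weighted_hess x (fun p => 1 - x p) A m.+1 u u) _ e7 e8) => //.
- by rewrite PE; lra.
- rewrite (weighted_hess_test X sn0 x1) (dquot_test sn0) (dskip_quot_test sn0) kE3 kE4 -/k.
  have vE : (k + 2) * elsym x A m.+4 / elsym x A m.+1 =
     (k + 2) * (elsym x A m.+4 / elsym x A m.+1) by rewrite mulrA.
  rewrite vE; apply: le_trans (weighted_hess_test_le k1 y0 q1 qy (ltW f0) f1 _ _) _.
  + by rewrite normrM normfV [X in _ / X]gtr0_norm // ler_pdivrMr.
  + apply: (newton_ratio_ge s0 y0 (ltW f0) f1 qy W3).
    by rewrite -eE; exact: (newton_weak x A m.+3).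
  + by rewrite lerD2l.
- apply: le_trans DW _; apply: le_trans (_ : e7 / 2 * (2 * h) * S + e7 / 2 * (d * h) * G <= _).
    by rewrite lerD // ler_wpM2r.
  apply: le_trans (_ : e7 * (d * h * G + 2 * h * S) <= _); last first.
    by rewrite ler_pM2l // PE; lra.
  by have := mulr_ge0 (ltW e70) hG0; have := mulr_ge0 (ltW e70) hS0; lra.
- by rewrite kE3 -/k in CS.
Qed.
End DegenerateRegime.

(** * Reduction to largest entry 1 *)

Section Removal.
Variables (R : comNzRingType) (T : finType).
Implicit Types (x u : T -> R) (A : {set T}) (j : nat).

Lemma delsym_rem x A p j u : p \in A ->
  delsym x A j.+1 u = delsym x (A :\ p) j.+1 u + u p * elsym x (A :\ p) j
                      + x p * delsym x (A :\ p) j u.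
Proof.
move=> pA; rewrite {1}/delsym (big_setD1 p pA) /= {1}/delsym.
have E q : q \in A :\ p -> u q * elsym x (A :\ q) j =
   u q * elsym x (A :\ p :\ q) j + x p * (u q * pelsym x (A :\ p :\ q) j).
  by move=> qA; rewrite (elsym_rem x j (setD1_in pA qA)) setD1C; ring.
by rewrite (eq_bigr _ E) big_split /= -mulr_sumr addrA [X in X + _]addrC.
Qed.

Lemma d2elsym_rem x A p j u : p \in A ->
  d2elsym x A j.+2 u u = d2elsym x (A :\ p) j.+2 u u
    + 2 * (u p * delsym x (A :\ p) j.+1 u) + x p * d2elsym x (A :\ p) j.+1 u u.
Proof.
move=> pA; rewrite {1}/d2elsym (big_setD1 p pA) /= {1}/d2elsym.
have E q : q \in A :\ p -> u q * delsym x (A :\ q) j.+1 u =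
   u q * delsym x (A :\ p :\ q) j.+1 u + u p * (u q * elsym x (A :\ p :\ q) j)
   + x p * (u q * delsym x (A :\ p :\ q) j u).
  by move=> qA; rewrite (delsym_rem x j u (setD1_in pA qA)) setD1C; ring.
have F : \sum_(q in A :\ p) u q * elsym x (A :\ p :\ q) j =
   delsym x (A :\ p) j.+1 u by [].
by rewrite (eq_bigr _ E) !big_split /= -!mulr_sumr F /d2elsym /=; ring.
Qed.

End Removal.

Section Scaling.
Variables (R : realFieldType) (T : finType).
Implicit Types (x u : T -> R) (A : {set T}) (j : nat) (c : R).

Lemma elsym_scale c x A j : elsym (fun p => c * x p) A j = c ^+ j * elsym x A j.
Proof.
elim: j A => [|j IH] A; first by rewrite !elsym_zero expr0 mulr1.
have j0 : j.+1%:R != 0 :> R by rewrite pnatr_eq0.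
apply: (mulfI j0); rewrite -elsym_sum mulrCA -elsym_sum mulr_sumr.
by apply: eq_bigr => p _; rewrite IH exprS; ring.
Qed.

Lemma delsym_scale c x A j u :
  delsym (fun p => c * x p) A j.+1 u = c ^+ j * delsym x A j.+1 u.
Proof.
rewrite /delsym mulr_sumr; apply: eq_bigr => p _ /=.
by rewrite elsym_scale mulrCA.
Qed.

Lemma d2elsym_scale c x A j u v :
  d2elsym (fun p => c * x p) A j.+2 u v = c ^+ j * d2elsym x A j.+2 u v.
Proof.
rewrite /d2elsym mulr_sumr; apply: eq_bigr => p _ /=.
by rewrite delsym_scale mulrCA.
Qed.

Lemma gcone_scale c x A k : 0 < c -> gcone (fun p => c * x p) A k -> gcone x A k.
Proof.
move=> c0 H j jk; have := H j jk.
by rewrite elsym_scale pmulr_rgt0 // exprn_gt0.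
Qed.

End Scaling.

Section Bridge.
Variables (R : realType) (n : nat).
Implicit Types (l xi : 'rV[R]_n) (i : 'I_n) (k : nat).

Lemma sigma_elsym k l : sigma k l = elsym (l 0) setT k.
Proof.
rewrite sigmaE /elsym.
have -> : \prod_(i in [set: 'I_n]) (1 + l 0 i *: 'X) =
    \prod_i (l 0 i *: 'X + 1) :> {poly R}.
  by apply: eq_big => [i|i _]; rewrite ?inE // addrC.
rewrite bigA_distr coef_sum big_mkcond /=; apply: eq_bigr => J _.
rewrite -big_mkcond /= scaler_prodr coefZ coefXn eq_sym.
by case: eqP => _; rewrite ?mulr1 ?mulr0.
Qed.

Lemma zero_at_elsym k l i (A : {set 'I_n}) : i \in A ->
  elsym (zero_at i l 0) A k = elsym (l 0) (A :\ i) k.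
Proof.
move=> iA; rewrite (elsym_rem _ _ iA) mxE eqxx mul0r addr0.
by apply: eq_elsym => p /setD1P[/negPf pi _]; rewrite mxE pi.
Qed.

Lemma sigma1_elsym k l i : sigma1 k l i = elsym (l 0) (setT :\ i) k.
Proof. by rewrite /sigma1 sigma_elsym zero_at_elsym. Qed.

Lemma sigma2_elsym k l i j : i != j ->
  sigma2 k l i j = elsym (l 0) (setT :\ i :\ j) k.
Proof.
move=> ij; rewrite /sigma2 sigma_elsym zero_at_elsym ?inE //.
by rewrite zero_at_elsym ?inE ?ij // setD1C.
Qed.

Lemma dF_delsym k l xi : \sum_i dF k.+1 l i * xi 0 i = delsym (l 0) setT k.+1 (xi 0).
Proof.
rewrite /delsym; apply: eq_big => [i|i _]; first by rewrite inE.
by rewrite /dF sigma1_elsym mulrC.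
Qed.

Lemma ddF_d2elsym k l xi : \sum_i \sum_j ddF k.+2 l i j * xi 0 i * xi 0 j =
  d2elsym (l 0) setT k.+2 (xi 0) (xi 0).
Proof.
rewrite /d2elsym; apply: eq_big => [i|i _]; first by rewrite inE.
rewrite /= /delsym mulr_sumr [RHS]big_mkcond; apply: eq_bigr => j _.
rewrite !inE andbT /ddF eq_sym; have [//|ij] := eqVneq j i.
  by rewrite !mul0r.
by rewrite sigma2_elsym 1?eq_sym // /=; ring.
Qed.

End Bridge.

(** * Completing squares and the three regimes *)

Section Core.
Variable (R : realFieldType).

(** With [e = xi + D], the terms in [e] and [z] form a square plus [(c / h) e^2] by the
hypothesis on [d] and [c], while [(c / h) e^2] and [D^2 / U] together dominate
[gamma xi^2] by Cauchy-Schwarz. *)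
Lemma complete_squares (h m z v q D d U c gamma xi : R) :
  0 < h -> 0 <= m -> 0 < c -> c < 2 -> 0 < U -> 0 < gamma ->
  (m + 1) * v <= m * z ^+ 2 ->
  1 <= ((m + 2) / (m + 1) - d) * (2 - c) ->
  D ^+ 2 <= U * (d * h * z ^+ 2 + q) ->
  gamma * (h / c + U) <= 1 ->
  0 <= 2 / h * (xi + D + h * z) ^+ 2 - gamma * xi ^+ 2 - 2 * (xi + D) * z
       - h * v + q.
Proof.
move=> h0 m0 c0 c2 U0 g0 hv hd HD Hg.
set e := xi + D.
have m1 : 0 < m + 1 by lra.
have c2' : 0 < 2 - c by lra.
have hv' : h * v <= h * (m / (m + 1) * z ^+ 2).
  by rewrite ler_pM2l // mulrAC ler_pdivlMr // mulrC.
have S1 : 0 <= (2 - c) / h * e ^+ 2 + 2 * e * z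
     + h * (((m + 2) / (m + 1) - d) * z ^+ 2).
  have : 0 <= (((2 - c) * e + h * z) ^+ 2
      + h ^+ 2 * z ^+ 2 * (((m + 2) / (m + 1) - d) * (2 - c) - 1)) / ((2 - c) * h).
    apply: divr_ge0; last by rewrite mulr_ge0 // ltW.
    by rewrite addr_ge0 ?sqr_ge0 // mulr_ge0 ?subr_ge0 // mulr_ge0 ?sqr_ge0.
  move=> H; apply: le_trans H _; rewrite le_eqVlt; apply/orP; left; apply/eqP.
  by field; rewrite !gt_eqF.
have S2 : gamma * xi ^+ 2 <= c / h * e ^+ 2 + (d * h * z ^+ 2 + q).
  have K : xi ^+ 2 <= (h / c + U) * (c / h * e ^+ 2 + (d * h * z ^+ 2 + q)).
    have -> : xi = e + - D by rewrite /e addrK.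
    have P0 : 0 <= d * h * z ^+ 2 + q.
      by rewrite -(pmulr_rge0 _ U0); apply: le_trans HD; exact: sqr_ge0.
    apply: sqr_add_le => //; rewrite ?sqrrN //.
    - by rewrite divr_ge0 // ltW.
    - exact: ltW.
    - by rewrite mulr_ge0 ?sqr_ge0 // divr_ge0 // ltW.
    by rewrite mulrA mulf_div [c * h]mulrC divff ?mul1r // mulf_neq0 ?gt_eqF.
  have hU : 0 < h / c + U by rewrite addr_gt0 ?divr_gt0.
  rewrite -(ler_pM2l hU); apply: le_trans K.
  by have := ler_wpM2r (sqr_ge0 xi) Hg; rewrite mul1r [leLHS]mulrAC [leLHS]mulrC.
have E : 2 / h * (e + h * z) ^+ 2 - 2 * e * z =
  2 / h * e ^+ 2 + 2 * e * z + 2 * h * z ^+ 2 by field; rewrite gt_eqF.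
have E2 : h * (((m + 2) / (m + 1) - d) * z ^+ 2) + h * (m / (m + 1) * z ^+ 2)
  + d * h * z ^+ 2 = 2 * h * z ^+ 2 by field; rewrite gt_eqF.
have E3 : (2 - c) / h * e ^+ 2 + c / h * e ^+ 2 = 2 / h * e ^+ 2.
  by field; rewrite gt_eqF.
lra.
Qed.

End Core.

Section Normalized.
Variables (R : realFieldType) (T : finType).
Implicit Types (x u w : T -> R) (A : {set T}) (j k m : nat) (s t d : R).

(** The quadratic form of the theorem for [lambda_1 = 1] and [k = m + 2]; the
second derivative of [F] is expanded with respect to [lambda_1]. *)
Definition normalized_form A m (gamma : R) x (xi : R) u : R :=
  2 / (elsym x A m.+2 + elsym x A m.+1) *
    (delsym x A m.+2 u + elsym x A m.+1 * xi + delsym x A m.+1 u) ^+ 2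
  - gamma * elsym x A m.+1 * xi ^+ 2
  - (d2elsym x A m.+2 u u + 2 * (xi * delsym x A m.+1 u) + d2elsym x A m.+1 u u)
  + 2 * \sum_(p in A) (elsym x (A :\ p) m.+1 + elsym x (A :\ p) m) / (1 - x p) * u p ^+ 2.

Lemma normalized_form_ge0 A m (gamma : R) x xi u d c U :
  gcone x A m.+1 -> (forall p, p \in A -> x p < 1) ->
  0 < 1 + quot x A m.+1 -> 0 < gamma -> 0 < c -> c < 2 -> 0 < U ->
  1 <= (m.+2%:R / m.+1%:R - d) * (2 - c) ->
  dquot x A m.+1 u ^+ 2 <= U * reduced_form x A m d u ->
  gamma * ((1 + quot x A m.+1) / c + U) <= 1 ->
  0 <= normalized_form A m gamma x xi u.
Proof.
move=> xA x1 h0 g0 c0 c2 U0 hd HD Hg; have s0 := xA m.+1 (leqnn _).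
have HC := elsym_root_concave u xA.
set T2 := \sum_(p in A) diag_weight x A m p * u p ^+ 2.
have TE : \sum_(p in A) (elsym x (A :\ p) m.+1 + elsym x (A :\ p) m) / (1 - x p)
    * u p ^+ 2 = elsym x A m.+1 * T2.
  rewrite mulr_sumr; apply: eq_bigr => p pA; rewrite /diag_weight.
  by field; rewrite (gt_eqF s0) subr_eq0 gt_eqF // x1.
have eE : elsym x A m.+2 = quot x A m.+1 * elsym x A m.+1.
  by rewrite /quot divfK // gt_eqF.
have dE : delsym x A m.+2 u = elsym x A m.+1 * dquot x A m.+1 u
   + quot x A m.+1 * delsym x A m.+1 u.
  by rewrite /dquot [_ * (_ / _)]mulrC divfK ?gt_eqF // subrK.
have d2E : d2elsym x A m.+2 u u = elsym x A m.+1 * d2quot x A m.+1 u u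
   + quot x A m.+1 * d2elsym x A m.+1 u u
   + 2 * (dquot x A m.+1 u * delsym x A m.+1 u).
  by rewrite /d2quot; field; rewrite gt_eqF.
rewrite /normalized_form TE eE dE d2E; rewrite /reduced_form -/T2 in HD.
move: HC HD Hg s0 h0; clear -hd g0 c0 c2 U0.
move: (elsym x A m.+1) (delsym x A m.+1 u) (d2elsym x A m.+1 u u)
  (quot x A m.+1) (dquot x A m.+1 u) (d2quot x A m.+1 u u) T2.
move=> s s1 s2 q D D2 T2 HC HD Hg s0 h0.
have mE1 : m.+1%:R = m%:R + 1 :> R by rewrite natr1.
have mE2 : m.+2%:R = m%:R + 2 :> R by rewrite -addn2 natrD.
rewrite mE1 mE2 in hd HC.
have HC' : (m%:R + 1) * (s2 / s) <= m%:R * (s1 / s) ^+ 2.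
  rewrite expr_div_n [leRHS]mulrA ler_pdivlMr ?exprn_gt0 //.
  by have -> : (m%:R + 1) * (s2 / s) * s ^+ 2 = (m%:R + 1) * (s * s2)
    by field; rewrite gt_eqF.
rewrite -addrA in HD.
have := complete_squares xi h0 (ler0n R m) c0 c2 U0 g0 HC' hd HD Hg.
move=> H; rewrite -[leRHS](divfK (lt0r_neq0 s0)) mulr_ge0 ?(ltW s0) //; apply: le_trans H _.
rewrite le_eqVlt; apply/orP; left; apply/eqP; field.
have qs : 0 < q * s + s by rewrite -[X in _ + X]mul1r -mulrDl mulr_gt0 // addrC.
by rewrite !gt_eqF.
Qed.

End Normalized.

Section Main.
Variables (R : realFieldType) (T : finType).
Implicit Types (x u w : T -> R) (A : {set T}) (j k m : nat) (s t d : R).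

(** The three regimes of the introduction, distinguished by the size of
[h = 1 + quot x A m.+1] and by the sign of [quot x A m.+1] up to a small margin. *)
Lemma normalized_form_ge0_small A m (gamma : R) :
  let k : R := m.+2%:R in let n : R := #|A|%:R + 1 in
  (m.+2 <= #|A|)%N -> 0 < gamma ->
  n / (2 * k) < gamma^-1 ->
  k / (k + 1) + n / (2 * k * (k + 1)) < gamma^-1 ->
  exists2 eta : R, 0 < eta & forall x xi u,
    gcone x A m.+1 -> (forall p, p \in A -> x p < 1) ->
    (forall p, p \in A -> 1 - x p <= n) ->
    0 < elsym x A m.+2 + elsym x A m.+1 <= eta ->
    0 <= normalized_form A m gamma x xi u.
Proof.
move=> k n mA g0 M1 M2.
have k2 : 2 <= k by rewrite /k ler_nat.
have nk : k + 1 <= n by rewrite /k /n lerD2r ler_nat.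
have kE : m.+2%:R = k by [].
have kE1 : m.+1%:R = k - 1 :> R by rewrite /k -[m.+2%:R]natr1 addrK.
have nE : n = #|A|%:R + 1 by [].
clearbody k n.
have k0 : 0 < k by lra.
have kp : 0 < k + 1 by lra.
have n0 : 0 < n by lra.
(* The slack in the two upper bounds on [gamma]; the factor 8 covers all losses. *)
pose e := Num.min 1 (Num.min (gamma^-1 - n / (2 * k))
  (gamma^-1 - (k / (k + 1) + n / (2 * k * (k + 1))))) / 8.
have e8 : 8 * e <= 1.
  by rewrite /e mulrC divfK ?pnatr_eq0 // ge_min lexx.
have eM1 : n / (2 * k) + 8 * e <= gamma^-1.
  rewrite -lerBrDl /e [8 * _]mulrC divfK ?pnatr_eq0 //.
  by rewrite !ge_min lexx !orbT.
have eM2 : k / (k + 1) + n / (2 * k * (k + 1)) + 8 * e <= gamma^-1.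
  rewrite -lerBrDl /e [8 * _]mulrC divfK ?pnatr_eq0 //.
  by rewrite !ge_min lexx !orbT.
have e0 : 0 < e by rewrite divr_gt0 // !lt_min ltr01 !subr_gt0 M1 M2.
clearbody e.
set r := k / (k + 1) in M2 eM2.
have r1 : r < 1 by rewrite ltr_pdivrMr //; lra.
have r2 : 2 / 3 <= r by rewrite ler_pdivlMr //; lra.
(* [c] is slightly below its limit [(k + 1) / k], which leaves room for [d > 0]. *)
pose c := (r + e)^-1.
have re0 : 0 < r + e by lra.
have c0 : 0 < c by rewrite invr_gt0.
have c2 : c < 2 by rewrite -[2]invrK ltf_pV2 ?posrE //; lra.
have crk : c < (k + 1) / k.
  by rewrite -[(k + 1) / k]invrK invf_div ltf_pV2 ?posrE ?divr_gt0 // ltrDl.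
pose d := k / (k - 1) - (2 - c)^-1.
have k10 : 0 < k - 1 by lra.
have d0 : 0 < d.
  have c2' : 0 < 2 - c by rewrite subr_gt0.
  rewrite subr_gt0 -[k / (k - 1)]invrK invf_div ltf_pV2 ?posrE ?divr_gt0 //.
  have -> : (k - 1) / k = 2 - (k + 1) / k by field; rewrite gt_eqF.
  by rewrite ltrD2l ltrN2.
have hd : 1 <= (m.+2%:R / m.+1%:R - d) * (2 - c).
  by rewrite kE kE1 /d opprB addrCA subrr addr0 mulVf // subr_eq0 gt_eqF.
pose N : R := #|A|%:R.
rewrite -/N in nE.
have N0 : 0 <= N by rewrite ler0n.
pose e1 := e / (N + 1).
have e10 : 0 < e1 by rewrite divr_gt0 // -nE.
have e1N : e1 * N <= e.
  rewrite /e1 mulrAC ler_pdivrMr -?nE // ler_pM2l // nE; lra.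
(* Small enough for [reduced_form_bound_shift] with shift [e1], as [h > e] and
   [1 - x_p <= n] there. *)
pose y0 := Num.min e (e1 * e / (2 * n)).
have y00 : 0 < y0.
  by rewrite lt_min e0 /= divr_gt0 // mulr_gt0.
have y0e : y0 <= e by rewrite ge_min lexx.
have y0B : n * (y0 + y0) <= e1 * e.
  have : y0 <= e1 * e / (2 * n) by rewrite ge_min lexx orbT.
  by rewrite ler_pdivlMr ?mulr_gt0 //; lra.
have mA1 : (m.+1 <= #|A|)%N by apply: ltnW.
have [L1 L10 HG] := elsym_rem_small T m y00.
have [L2 L20 HD] := reduced_form_bound_degenerate mA1 n0 e0 y00 d0 e0.
pose L := L1 + L2 + e^-1.
have ei0 : 0 < e^-1 by rewrite invr_gt0.
have L0 : 0 < L by rewrite /L !addr_gt0.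
(* For [h > e] this forces [s <= L^{-(m+1)}], so Maclaurin gives
   [sigma_m >= L sigma_{m+1}]. *)
exists (e * (L^-1) ^+ m.+1); first by rewrite mulr_gt0 // exprn_gt0 // invr_gt0.
move=> x xi u xA x1 xB /andP[F0 FL].
have s0 := xA m.+1 (leqnn _).
have FE : elsym x A m.+2 + elsym x A m.+1 = (1 + quot x A m.+1) * elsym x A m.+1.
  by rewrite mulrDl mul1r addrC /quot divfK // gt_eqF.
have hp : 0 < 1 + quot x A m.+1 by move: F0; rewrite FE pmulr_lgt0.
have core U : 0 < U -> (1 + quot x A m.+1) * (r + e) + U <= gamma^-1 ->
    dquot x A m.+1 u ^+ 2 <= U * reduced_form x A m d u -> 0 <= normalized_form A m gamma x xi u.
  move=> U0 HU HP; apply: (normalized_form_ge0 xi xA x1 hp g0 c0 c2 U0 hd HP).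
  by rewrite /c invrK mulrC -ler_pdivlMr // div1r.
(* For [h <= e] the size of [F] is irrelevant: the shift to the vector of ones only
   needs the first upper bound on [gamma]. *)
have [hs|hs] := lerP (1 + quot x A m.+1) e.
  have B := reduced_form_bound_far u mA1 x1 xA (ltW d0) (ltW hp).
  have UE : (#|A|%:R - m.+1%:R) / m.+2%:R - quot x A m.+1 = n / k - (1 + quot x A m.+1).
    by rewrite nE kE kE1; field; rewrite gt_eqF.
  rewrite UE in B.
  have nk1 : 1 <= n / k by rewrite ler_pdivlMr //; lra.
  apply: (core ((n / k - (1 + quot x A m.+1)) / 2)).
  - by rewrite divr_gt0 // subr_gt0; lra.
  - apply: le_trans eM1; have -> : n / (2 * k) = n / k / 2.
      by field; rewrite gt_eqF.
    have : (1 + quot x A m.+1) * (r + e) <= (1 + quot x A m.+1) * 2.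
      by rewrite ler_pM2l //; lra.
    by lra.
  - by rewrite mulrAC ler_pdivlMr // mulrC.
have sL : elsym x A m.+1 <= (L^-1) ^+ m.+1.
  rewrite -(ler_pM2l e0); apply: le_trans FL; rewrite FE ler_pM2r //; exact: ltW.
have qL : quot x A m <= L^-1.
  rewrite leNgt; apply/negP => qL.
  have := le_trans (quot_expn_le xA) sL.
  by rewrite leNgt ltrXn2r ?nnegrE ?invr_ge0 ?(ltW L0) // ltW // quot_gt0.
have fL : L * elsym x A m.+1 <= elsym x A m.
  have f0 := xA m (leqnSn _).
  by move: qL; rewrite /quot ler_pdivrMr // mulrC ler_pdivlMr // mulrC.
have f1 : L1 * elsym x A m.+1 <= elsym x A m.
  by apply: le_trans fL; rewrite ler_pM2r // /L; lra.
have f2 : L2 * elsym x A m.+1 <= elsym x A m.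
  by apply: le_trans fL; rewrite ler_pM2r // /L; lra.
have f3 : e^-1 * elsym x A m.+1 <= elsym x A m.
  by apply: le_trans fL; rewrite ler_pM2r // /L; lra.
have qe : quot x A m.+1 <= e.
  have f0 := xA m (leqnSn _); apply: le_trans (quot_mono xA) _.
  by rewrite /quot ler_pdivrMr // -ler_pdivrMl.
have ne : 0 < n / (2 * k * (k + 1)) by rewrite divr_gt0 ?mulr_gt0.
(* For [q >= - y0] the bound by [y0] on the quotients with one variable removed
   makes the shift by [e1] admissible. *)
have [qy|qy] := lerP (- y0) (quot x A m.+1).
  have rem p : p \in A -> elsym x (A :\ p) m.+1 <= y0 * elsym x (A :\ p) m.
    move=> pA; apply: HG => //; have : - elsym x A m.+1 <= elsym x A m.+2.
      by rewrite FE in F0; lra.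
    by [].
  have B := reduced_form_bound_shift u x1 xB xA (ltW d0) e10 e0 (ltW y00) (ltW y00)
    (ltW hs) qy rem y0B.
  apply: (core ((y0 + e1 * #|A|%:R) / 2)).
  - by rewrite divr_gt0 // ltr_pwDl // mulr_ge0 // ltW.
  - apply: le_trans eM2; rewrite -/N.
    have : (1 + quot x A m.+1) * (r + e) <= (1 + e) * (r + e).
      by rewrite ler_pM2r // lerD2l.
    have : e * (r + e) <= e * 2 by rewrite ler_pM2l //; lra.
    by lra.
  - by rewrite mulrAC ler_pdivlMr // mulrC.
(* Since [q < 0] and [r >= 1 / 2], the sum of [(1 + q) r] and [(1 / k - q) / 2] is at
   most its value at [q = 0]. *)
have B := HD x u x1 xB xA (ltW hs) (ltW qy) f2.
apply: (core ((m.+2%:R^-1 - quot x A m.+1) / 2 + e)) => //.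
  by have : 0 < k^-1 by [rewrite invr_gt0]; rewrite kE; lra.
apply: le_trans eM2; rewrite kE.
have k1n : k^-1 / 2 <= n / (2 * k * (k + 1)).
  have -> : k^-1 / 2 = (k + 1) / (2 * k * (k + 1)) by field; rewrite !gt_eqF.
  by rewrite ler_pM2r // invr_gt0 !mulr_gt0.
have q0 : quot x A m.+1 <= 0 by apply: le_trans (ltW qy) _; rewrite oppr_le0 ltW.
have : quot x A m.+1 * (r - 1 / 2) <= 0.
  by rewrite mulr_le0_ge0 // ?subr_ge0 //; clear -r2; lra.
have : quot x A m.+1 * e <= 0 by rewrite mulr_le0_ge0 // ltW.
by lra.
Qed.

End Main.

(** The form is homogeneous of degree [k - 3] in [lambda]. *)
Lemma Qform_normalized_form (R : realType) n (i1 : 'I_n) m (gamma a : R) (l xi : 'rV[R]_n)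
    (x := fun p => a^-1 * l 0 p) (A := [set~ i1]) :
  l 0 i1 = a -> 0 < a ->
  (forall p, p \in A -> x p < 1) ->
  0 < elsym x A m.+2 + elsym x A m.+1 ->
  Qform i1 m.+2 gamma l xi =
  a ^+ m / a * normalized_form A m gamma x (xi 0 i1) (xi 0).
Proof.
move=> aE a0 x1 F0.
have an0 : a != 0 by rewrite gt_eqF.
have iT : i1 \in [set: 'I_n] by rewrite inE.
have AE : setT :\ i1 = A by rewrite setTD.
have lE : l 0 =1 (fun p => a * x p) by move=> p; rewrite /x mulrA mulfV ?mul1r.
have eS B j : elsym (l 0) B j = a ^+ j * elsym x B j.
  by rewrite -elsym_scale; apply: eq_elsym => p _.
have dS B j u : delsym (l 0) B j.+1 u = a ^+ j * delsym x B j.+1 u.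
  by rewrite -delsym_scale; apply: eq_delsym.
have d2S B j u v : d2elsym (l 0) B j.+2 u v = a ^+ j * d2elsym x B j.+2 u v.
  by rewrite -d2elsym_scale; apply: eq_d2elsym.
have x1i : x i1 = 1 by rewrite /x aE mulVf.
have FE : sigma m.+2 l = a ^+ m.+2 * (elsym x A m.+2 + elsym x A m.+1).
  by rewrite sigma_elsym eS (elsym_rem _ _ iT) AE x1i mul1r.
clearbody x.
have F1E p : p != i1 -> dF m.+2 l p =
    a ^+ m.+1 * (elsym x (A :\ p) m.+1 + elsym x (A :\ p) m).
  move=> pi; have ip : i1 \in setT :\ p by rewrite !inE eq_sym pi.
  by rewrite /dF sigma1_elsym eS (elsym_rem _ _ ip) setD1C AE x1i mul1r.
have F11 : dF m.+2 l i1 = a ^+ m.+1 * elsym x A m.+1.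
  by rewrite /dF sigma1_elsym eS AE.
have T4 : \sum_(p | p != i1) dF m.+2 l p / (a - l 0 p) * xi 0 p ^+ 2 =
  a ^+ m * \sum_(p in A) (elsym x (A :\ p) m.+1 + elsym x (A :\ p) m) / (1 - x p)
    * xi 0 p ^+ 2.
  rewrite mulr_sumr; apply: eq_big => [p|p pi]; first by rewrite !inE.
  have x0 : 1 - x p != 0 by rewrite subr_eq0 gt_eqF // x1 // !inE.
  rewrite F1E // lE; have -> : a - a * x p = a * (1 - x p) by ring.
  by rewrite exprS; field; rewrite an0 x0.
rewrite /Qform aE T4 F11 FE dF_delsym ddF_d2elsym dS d2S.
rewrite (delsym_rem x _ _ iT) (d2elsym_rem x _ _ iT) AE x1i !mul1r /normalized_form.
by rewrite !exprS; field; rewrite an0 gt_eqF //= expf_neq0.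
Qed.

(** * The theorem *)

Theorem theorem1p1 (R : realType) (n k : nat) (hn : (3 <= n)%N)
    (hk : (2 <= k < n)%N) (gamma : R) (hgamma0 : 0 < gamma)
    (hgamma : gamma < Num.min (2 * k%:R / n%:R)
       (1 + (2 * k%:R - n%:R) / (2 * k%:R ^+ 2 + n%:R))) :
  exists eta : R, 0 < eta /\
    forall l : 'rV[R]_n,
      Garding k l ->
      simple_top_sorted (first_ord hn) l ->
      0 < sigma k l / l 0 (first_ord hn) ^+ k <= eta ->
      forall xi : 'rV[R]_n, 0 <= Qform (first_ord hn) k gamma l xi.
Proof.
set i1 := first_ord hn; have /andP[k2 kn] := hk.
case: k k2 kn hk hgamma => [//|[//|m]] _ kn _.
rewrite lt_min => /andP[g1 g2].
pose A := [set~ i1].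
have cA : #|A| = n.-1 by rewrite cardsC1 card_ord.
have n0 : (0 < n)%N by apply: ltn_trans kn.
have NE : #|A|%:R + 1 = n%:R :> R by rewrite cA natr1 prednK.
have mA : (m.+2 <= #|A|)%N by rewrite cA -ltnS prednK.
have n0R : 0 < n%:R :> R by rewrite ltr0n.
have k0R : 0 < m.+2%:R :> R by rewrite ltr0n.
have k1R : 0 < m.+2%:R + 1 :> R by rewrite addr_gt0.
have kkR : 0 < 2 * m.+2%:R * (m.+2%:R + 1) :> R by rewrite !mulr_gt0.
have [||eta eta0 H] := @normalized_form_ge0_small R _ A m gamma mA hgamma0.
- rewrite NE -[ltLHS]invrK ltf_pV2 ?posrE ?invr_gt0 ?divr_gt0 ?mulr_gt0 //.
  by rewrite invf_div.
- rewrite NE; move: g2 k0R k1R kkR; move: (m.+2%:R : R) (n%:R : R) n0R.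
  move=> kk nn n0R g2 k0R k1R kkR.
  have d0 : 0 < 2 * kk ^+ 2 + nn by rewrite addr_gt0 // mulr_gt0 // exprn_gt0.
  have -> : kk / (kk + 1) + nn / (2 * kk * (kk + 1)) =
     (2 * kk ^+ 2 + nn) / (2 * kk * (kk + 1)).
    by field; rewrite (gt_eqF k0R) (gt_eqF k1R).
  rewrite -[ltLHS]invrK ltf_pV2 ?posrE ?invr_gt0 ?divr_gt0 //.
  rewrite invf_div; apply: lt_le_trans g2 _; rewrite le_eqVlt; apply/orP; left.
  by apply/eqP; field; rewrite gt_eqF.
exists eta; split=> // l Gl [l1 _] /andP[F0 FL] xi.
have gl : gcone (l 0) setT m.+2.
  by move=> [_|j jk]; rewrite ?elsym_zero // -sigma_elsym Gl.
have iT : i1 \in [set: 'I_n] by rewrite inE.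
have AE : setT :\ i1 = A by rewrite setTD.
have a0 : 0 < l 0 i1.
  have := gl 1 isT; rewrite elsym_one => S0; rewrite ltNge; apply/negP => a0.
  move: S0; rewrite ltNge sumr_le0 // => p _; have [->//|pi] := eqVneq p i1.
  by apply: le_trans a0; apply: ltW; apply: l1.
set a := l 0 i1 in a0 *.
have an0 : a != 0 by rewrite gt_eqF.
pose x p := a^-1 * l 0 p.
have lE : l 0 =1 (fun p => a * x p) by move=> p; rewrite /x mulrA mulfV ?mul1r.
have gx : gcone x setT m.+2.
  apply: (gcone_scale a0) => j jm.
  by rewrite (@eq_elsym _ _ _ (l 0)) ?gl // => p _; rewrite lE.
have x1i : x i1 = 1 by rewrite /x mulVf.
have x1 p : p \in A -> x p < 1.
  by rewrite !inE => pi; rewrite /x mulrC ltr_pdivrMr // mul1r l1.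
have xA : gcone x A m.+1 by rewrite -AE; apply: gcone_rem.
have FE : sigma m.+2 l = a ^+ m.+2 * (elsym x A m.+2 + elsym x A m.+1).
  rewrite sigma_elsym (@eq_elsym _ _ _ (fun p => a * x p)) => [|p _]; last exact: lE.
  by rewrite elsym_scale (elsym_rem _ _ iT) AE x1i mul1r.
have FA : sigma m.+2 l / a ^+ m.+2 = elsym x A m.+2 + elsym x A m.+1.
  by rewrite FE mulrC mulKf // expf_neq0.
rewrite FA in F0 FL.
rewrite (@Qform_normalized_form _ _ i1 m gamma a l xi erefl a0 x1 F0).
rewrite mulr_ge0 ?divr_ge0 ?exprn_ge0 ?(ltW a0) //.
apply: H => //; last by rewrite F0.
move=> p pA; rewrite NE.
have := gx 1 isT; rewrite elsym_one (big_setD1 i1 iT) /= AE (big_setD1 p pA) /=.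
rewrite x1i => S0.
have : \sum_(q in A :\ p) x q <= \sum_(q in A :\ p) 1.
  by apply: ler_sum => q /setD1P[_ qA]; apply/ltW/x1.
rewrite sumr_const => S1.
have cAp : #|A :\ p|%:R + 1 + 1 = n%:R :> R.
  by rewrite -NE (cardsD1 p A) pA natrD [1 + _]addrC.
by rewrite -[a^-1 * _]/(x p); lra.
Qed.
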